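(* Let $\eta\in\mathbb N\cup\{\infty\}$ and $\kappa\in\mathbb Z_+$, let $X=X_{\eta,\kappa}$ and $\phi=\phi_{\eta,\kappa}$ be the set and self-map described in the context, and let $\mu$ be a discrete measure on $X$. Suppose that (i-a) $\{\mathsf h_{\phi^n}(x_{i,1})\}_{n=0}^\infty$ is a Stieltjes moment sequence for every $i\in J_\eta$, and that $\{P(x_{i,1},\cdot)\}_{i\in J_\eta}$ is a family of Borel probability measures on $\mathbb R_+$ such that (i-b) for every $i\in J_\eta$, $P(x_{i,1},\cdot)$ is an S-representing measure of $\{\mathsf h_{\phi^n}(x_{i,1})\}_{n=0}^\infty$ vanishing on $[0,1]$, (i-c) $\sum_{i=1}^{\eta}\frac{\mu(x_{i,1})}{\mu(x_r)}\int_0^\infty\frac{t^r-1}{t^{\kappa+1}-1}P(x_{i,1},dt)+\frac{\mu(x_0)}{\mu(x_r)}=1$ for every $r\in J_\kappa$, (i-d$'$) $\sum_{i=1}^{\eta}\mu(x_{i,1})\int_0^\infty\frac1{t^{\kappa+1}-1}P(x_{i,1},dt)<\infty$. Consider the following three conditions: (e1) $\{\mathsf h_{\phi^n}(x_\kappa)+c\}_{n=0}^\infty$ is an S-determinate Stieltjes moment sequence for every $c\in(0,\infty)$, (e2) $\{\mathsf h_{\phi^{n+1}}(x_\kappa)+c\}_{n=0}^\infty$ is an S-determinate Stieltjes moment sequence for every $c\in(0,\infty)$, (e3) $\{\mathsf h_{\phi^n}(x_\kappa)\}_{n=0}^\infty$ is a Stieltjes moment sequence that satisfies the Carleman condition.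 Then (e3)$\Rightarrow$(e2)$\Rightarrow$(e1) and, if (e1) holds, then the composition operator $C_\phi$ in $L^2(\mu)$ is densely defined and there exists a family $\{P(x,\cdot)\}_{x\in X\setminus\{x_{i,1}:i\in J_\eta\}}$ of Borel probability measures on $\mathbb R_+$ such that $\{P(x,\cdot)\}_{x\in X}$ satisfies the consistency condition (CC). Moreover, if (e3) holds, then $\{\mathsf h_{\phi^n}(x_r)\}_{n=0}^\infty$ satisfies the Carleman condition for every $r\in\{0,\ldots,\kappa\}$.
   Context: Notation: $\mathbb N=\{1,2,\ldots\}$, $\mathbb Z_+=\{0,1,2,\ldots\}$, $\mathbb R_+=[0,\infty)$, $J_k=\{i\in\mathbb N:i\le k\}$ for $k\in\mathbb Z_+\cup\{\infty\}$ ($J_0=\emptyset$, $J_\infty=\mathbb N$); $0^0=1$; $\int_0^\infty$ means $\int_{[0,\infty)}$. All measures are positive. Integrals with denominator $t^{\kappa+1}-1$ are taken with respect to measures vanishing on $[0,1]$, i.e. effectively over $(1,\infty)$. The set and the symbol. $X=X_{\eta,\kappa}=\{x_0,\ldots,x_\kappa\}\cup\{x_{i,j}:i\in J_\eta,\ j\in\mathbb N\}$, all listed points being distinct, and $\phi=\phi_{\eta,\kappa}\colon X\to X$ is given by $\phi(x_{i,j})=x_{i,j-1}$ for $i\in J_\eta$, $j\ge2$; $\phi(x_{i,1})=x_\kappa$ for $i\in J_\eta$; $\phi(x_0)=x_\kappa$; $\phi(x_r)=x_{r-1}$ for $r\in J_\kappa$. Operators. A discrete measure on $X$ is a $\sigma$-finite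 measure $\mu$ on $2^X$ with $\mu(x):=\mu(\{x\})>0$ for all $x\in X$ (so $\mu(x)<\infty$ as well). The composition operator $C_\phi$ in $L^2(\mu)$ has domain $\{f\in L^2(\mu):f\circ\phi\in L^2(\mu)\}$ and $C_\phi f=f\circ\phi$. For $n\in\mathbb Z_+$, $\mathsf h_{\phi^n}(x)=\mu((\phi^n)^{-1}(\{x\}))/\mu(x)\in[0,\infty]$. Consistency condition. A family $\{P(x,\cdot)\}_{x\in X}$ of Borel probability measures on $\mathbb R_+$ satisfies (CC) if $\frac1{\mu(x)}\sum_{y\in\phi^{-1}(\{x\})}\mu(y)P(y,\sigma)=\int_\sigma t\,P(x,dt)$ for every Borel $\sigma\subseteq\mathbb R_+$ and every $x\in\phi(X)$. Moments. A real sequence $\{\gamma_n\}_{n=0}^\infty$ is a Stieltjes moment sequence if there is a Borel measure $\nu$ on $\mathbb R_+$ (an S-representing measure) with all moments finite and $\gamma_n=\int_0^\infty t^n\,d\nu(t)$ for all $n\in\mathbb Z_+$; it is S-determinate if it has exactly one S-representing measure. A sequence $\{\gamma_n\}_{n=0}^\infty\subseteq\mathbb R_+$ satisfies the Carleman condition if $\sum_{n=1}^\infty\gamma_n^{-1/(2n)}=\infty$, with the convention $\frac10=\infty$. *)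

(* Defs.v *)
(* MathComp-Analysis; the reals are an arbitrary [R : realType]. *)
From HB Require Import structures.
From mathcomp Require Import all_boot all_order all_algebra.
From mathcomp Require Import complex.
From mathcomp Require Import all_classical all_reals all_analysis.

Set Implicit Arguments.
Unset Strict Implicit.
Unset Printing Implicit Defensive.

Import Order.TTheory GRing.Theory Num.Theory.
Import numFieldNormedType.Exports.

Local Open Scope classical_set_scope.
Local Open Scope ring_scope.

(* J_k for k in {0, 1, 2, ...} \cup {oo}; [None] stands for oo. *)
Definition J_pred (k : option nat) : pred nat :=
  fun i => (0 < i)%N && (if k is Some m then (i <= m)%N else true).

Definition J (k : option nat) : Type := {i : nat | J_pred k i}.

HB.instance Definition _ (k : option nat) :=
  Countable.copy (J k) {i : nat | J_pred k i}.

(* The set X_{eta,kappa}: [circ r] is x_r for 0 <= r <= kappa, and the second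
   index of a branch point is shifted: [branch i j] is x_{i,j+1}. *)
Definition Xset (eta : option nat) (kappa : nat) : Type :=
  ('I_kappa.+1 + J eta * nat)%type.

Definition circ (eta : option nat) (kappa : nat) (r : 'I_kappa.+1) :
  Xset eta kappa := inl r.
Arguments circ eta {kappa} r.

Definition branch (eta : option nat) (kappa : nat) (i : J eta) (j : nat) :
  Xset eta kappa := inr (i, j).
Arguments branch {eta} kappa i j.

HB.instance Definition _ (eta : option nat) (kappa : nat) :=
  Countable.copy (Xset eta kappa) ('I_kappa.+1 + J eta * nat)%type.

HB.instance Definition _ (eta : option nat) (kappa : nat) :=
  isPointed.Build (Xset eta kappa) (circ eta (@ord0 kappa)).

(* Xset carries the sigma-algebra of all its subsets. *)
HB.instance Definition _ (eta : option nat) (kappa : nat) :=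
  @isMeasurable.Build default_measure_display (Xset eta kappa)
    discrete_measurable discrete_measurable0
    discrete_measurableC discrete_measurableU.

Definition phi (eta : option nat) (kappa : nat) (x : Xset eta kappa) :
    Xset eta kappa :=
  match x with
  | inl r => circ eta (if r == ord0 then ord_max else inord r.-1)
  | inr (i, j) => if j is j'.+1 then branch kappa i j' else circ eta ord_max
  end.

Local Open Scope ereal_scope.

(* sigma-finiteness together with positivity of the atoms gives
   0 < mu {x} < oo, so the quotients below are genuine ones. *)
Definition discrete_measure (R : realType) (eta : option nat) (kappa : nat)
    (mu : {measure set (Xset eta kappa) -> \bar R}) : Prop :=
  sigma_finite [set: Xset eta kappa] mu /\ (forall x, 0 < mu [set x]).

(* h_{phi^n}(x), with values in [0, oo]. *)
Definition hphi (R : realType) (eta : option nat) (kappa : nat)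
    (mu : {measure set (Xset eta kappa) -> \bar R}) (n : nat)
    (x : Xset eta kappa) : \bar R :=
  mu (iter n (@phi eta kappa) @^-1` [set x]) / mu [set x].

(* Complex L^2(mu).  All functions on X are measurable and all points have
   positive mass, so there is no quotient by a.e. equality to take. *)
Definition L2norm (R : realType) (eta : option nat) (kappa : nat)
    (mu : {measure set (Xset eta kappa) -> \bar R})
    (f : Xset eta kappa -> R[i]) : \bar R :=
  'N[mu]_2%:E[EFin \o @Normc.normc R \o f].

Definition L2 (R : realType) (eta : option nat) (kappa : nat)
    (mu : {measure set (Xset eta kappa) -> \bar R}) :
    set (Xset eta kappa -> R[i]) :=
  [set f | L2norm mu f < +oo].

Definition Cphi (R : realType) (eta : option nat) (kappa : nat)
    (f : Xset eta kappa -> R[i]) : Xset eta kappa -> R[i] :=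
  f \o @phi eta kappa.

Definition Cphi_dom (R : realType) (eta : option nat) (kappa : nat)
    (mu : {measure set (Xset eta kappa) -> \bar R}) :
    set (Xset eta kappa -> R[i]) :=
  [set f | L2 mu f /\ L2 mu (Cphi f)].

Definition Cphi_densely_defined (R : realType) (eta : option nat)
    (kappa : nat) (mu : {measure set (Xset eta kappa) -> \bar R}) : Prop :=
  forall g : Xset eta kappa -> R[i], L2 mu g ->
  forall e : R, (0 < e)%R ->
  exists2 f : Xset eta kappa -> R[i], Cphi_dom mu f &
    L2norm mu (fun x => (g x - f x)%R) < e%:E.

(* Borel measures on [0, oo) are Borel measures on R that do not charge
   the negative half-line. *)
Definition on_Rplus (R : realType)
    (nu : {measure set (measurableTypeR R) -> \bar R}) : Prop :=
  nu `]-oo, 0%R[%classic = 0.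

(* Sequences take values in \bar R; being representable forces them to be
   real, and all moments of the representing measure to be finite. *)
Definition S_representing (R : realType)
    (nu : {measure set (measurableTypeR R) -> \bar R}) (g : nat -> \bar R) :
    Prop :=
  on_Rplus nu /\
  forall n, g n \is a fin_num /\
    g n = \int[nu]_(t in `[0%R, +oo[%classic) (t ^+ n)%:E.

Definition Stieltjes (R : realType) (g : nat -> \bar R) : Prop :=
  exists nu : {measure set (measurableTypeR R) -> \bar R}, S_representing nu g.

Definition S_determinate (R : realType) (g : nat -> \bar R) : Prop :=
  exists2 nu : {measure set (measurableTypeR R) -> \bar R},
    S_representing nu g &
    forall nu' : {measure set (measurableTypeR R) -> \bar R},
      S_representing nu' g ->
      forall A : set (measurableTypeR R), measurable A -> nu' A = nu A.

(* The inverse on \bar R satisfies 0^-1 = +oo. *)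
Definition Carleman (R : realType) (g : nat -> \bar R) : Prop :=
  (forall n, g n \is a fin_num /\ 0 <= g n) /\
  \sum_(1 <= n <oo) (g n `^ ((2 * n)%:R^-1)%R)^-1 = +oo.

Definition CC (R : realType) (eta : option nat) (kappa : nat)
    (mu : {measure set (Xset eta kappa) -> \bar R})
    (P : Xset eta kappa -> probability (measurableTypeR R) R) : Prop :=
  forall s : set (measurableTypeR R), measurable s ->
    s `<=` `[0%R, +oo[%classic ->
  forall x : Xset eta kappa, range (@phi eta kappa) x ->
    (mu [set x])^-1 *
      (\esum_(y in @phi eta kappa @^-1` [set x]) (mu [set y] * P y s)) =
    \int[P x]_(t in s) t%:E.

(* Main.v *)
From HB Require Import structures.
Require Import Defs.
From mathcomp Require Import all_boot all_order all_algebra.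
From mathcomp Require Import all_classical all_reals all_analysis.
From mathcomp Require Import measurable_realfun complex ring lra.

Set Implicit Arguments.
Unset Strict Implicit.
Unset Printing Implicit Defensive.

Import Order.TTheory GRing.Theory Num.Theory.
Import numFieldNormedType.Exports.

Local Open Scope classical_set_scope.
Local Open Scope ring_scope.

(** The consistency condition leaves no choice but one number. Along a branch
    it says that P(x_{i,j+1}, .) is a multiple of t^j P(x_{i,1}, .). On the
    cycle put M_r = mu(x_r) P(x_r, .); then M_r = t^r M_0, and at x_kappa

      t^(kappa+1) M_0 = M_0 + sum_i mu(x_{i,1}) P(x_{i,1}, .).

    All the P(x_{i,1}, .) live on (1, oo), so M_0 = W + a delta_1 where
    W = sum_i mu(x_{i,1}) (t^(kappa+1) - 1)^-1 P(x_{i,1}, .), a finite measure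
    by [id'], and a = mu(x_0) - W(1, oo) because M_0 has mass mu(x_0).
    Whatever the sign of a, the signed measure W + a delta_1 has the right
    moments: the integral of t^(n+r) is mu(phi^-n {x_r}). This is
    [cycle_moment_identity], an induction on n whose base case is [ic]. Hence
    a consistent family exists as soon as a >= 0
    ([start_measure_exists], [consistent_family_exists]).

    Determinacy forces a >= 0 ([determinate_defect]). If a < 0, move the
    negative atom to the other side: with c = - a / mu(x_kappa), the sequence
    h_n(x_kappa) + c is represented by t^kappa W / mu(x_kappa), which does not
    charge 1. But a measure representing h_n(x_kappa) + c/2, to which the mass
    c/2 is added at 1, represents the same sequence and charges 1. The same
    argument works with h_{n+1} for h_n, so both e1 and e2 give a >= 0.

    For e2 -> e1, the number a >= 0 yields a representing measure of
    h_n + c, and two such measures nu, nu' satisfy t nu = t nu' by e2, hence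
    agree on (0, oo), and then at 0 by their total mass
    ([determinate_of_shifted]). For e3 -> e2, the Carleman condition passes
    from h_n to h_{n+1} and then to h_{n+1} + c, because h_n stays away from 0
    ([shifted_determinate]). It passes to the other points of the cycle
    because M_0 lives on [1, oo), so that the moments of t^r M_0 are at most
    those of t^kappa M_0 ([circ_Carleman]).

    What remains is Carleman's theorem for measures on [0, oo)
    ([carleman_determinacy]). If nu and nu' have the same moments, let
    f(s) be the integral of cos(s sqrt t) against nu - nu'. All derivatives of
    f vanish at 0, and the n-th one is bounded by M_n, the moment of order n/2
    of nu + nu'. The sequence M is log-convex, Carleman's inequality turns the
    Carleman condition into sum_n M_n / M_{n+1} = oo
    ([ratio_divergence]), and Bang's argument gives f = 0
    ([bang_vanishing]). A measure is determined by these cosine integrals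
    ([cosine_transform_unique]): powers of cosines converge to exp(- l t), and
    (1 - exp(- n t))^N with a suitable N converges to the indicator of a ray.

    The operator is densely defined as soon as every fibre of phi has finite
    mass, since functions of finite support are then in its domain
    ([Cphi_densely_defined_of_finite]). *)

(** * Taylor estimates for the cosine *)

Lemma sum_inv_fact_le (R : realType) (m : nat) :
  \sum_(j < m) (j`!%:R)^-1 <= expR 1 :> R.
Proof.
rewrite /expR; apply: limr_ge; first exact: is_cvg_series_exp_coeff.
near=> n; have mn : (m <= n)%N by near: n; exists m.
rewrite /series/= -(big_mkord xpredT (fun j => (j`!%:R)^-1)).
rewrite [leRHS](@big_cat_nat _ _ _ m)//=.
under [X in _ <= X + _]eq_bigr do rewrite /exp_coeff /= expr1n div1r.
rewrite lerDl; apply: sumr_ge0 => i _.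
by rewrite /exp_coeff /= expr1n div1r invr_ge0.
Unshelve. all: by end_near. Qed.

(** A closed form for the [n]-th derivative of the cosine. *)
Definition cosn (R : realType) (n : nat) (x : R) : R :=
  cos (x + n%:R * (pi / 2)).

Lemma cosn_norm_le1 (R : realType) n (x : R) : `|cosn n x| <= 1.
Proof. exact: cos_max. Qed.

Lemma is_derive_cosn (R : realType) (n : nat) (a x : R) :
  is_derive x 1 (fun y => cosn n (a + y)) (cosn n.+1 (a + x)).
Proof.
rewrite /cosn.
have -> : a + x + n.+1%:R * (pi / 2) = a + x + n%:R * (pi / 2) + pi / 2.
  by rewrite -[n.+1%:R]natr1; ring.
rewrite cosDpihalf.
have -> : (fun y : R => cos (a + y + n%:R * (pi / 2))) =
    cos \o shift (a + n%:R * (pi / 2)).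
  by apply/funext => y /=; congr cos; ring.
have := @is_derive1_comp R cos (shift (a + n%:R * (pi / 2))) x _ 1
  (is_derive_cos _) (is_derive_shift _ _ _).
by rewrite mulr1 /=; move=> /is_derive_eq; apply; congr (- sin _); ring.
Qed.

Lemma le_of_derive_le (R : realType) (f g df dg : R -> R) :
  (forall x : R, is_derive x 1 f (df x)) ->
  (forall x : R, is_derive x 1 g (dg x)) ->
  f 0 <= g 0 -> (forall x, 0 <= x -> df x <= dg x) ->
  forall x, 0 <= x -> f x <= g x.
Proof.
move=> fdf gdg fg0 dfg x x0.
have gf (y : R) : is_derive y 1 (g - f) (dg y - df y) by exact: is_deriveB.
have cgf : {within `[0, x], continuous (g - f)}.
  apply: continuous_subspaceT => y.
  by apply/differentiable_continuous/derivable1_diffP; case: (gf y).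
have [z z0x] := @MVT_segment R (g - f) (fun y => dg y - df y) 0 x x0
  (fun y _ => gf y) cgf.
rewrite subr0 /= => E; rewrite -subr_ge0.
have : g x - f x - (g 0 - f 0) = (dg z - df z) * x by [].
have : 0 <= (dg z - df z) * x.
  move: z0x; rewrite in_itv/= => /andP[z0 _].
  by rewrite mulr_ge0// subr_ge0 dfg.
lra.
Qed.

(** The remainder of order [m.+1] is a primitive of the remainder of order
    [m] of the next derivative, so the bound follows by integrating. *)
Lemma cosn_taylor (R : realType) (m n : nat) (a b : R) : 0 <= b ->
  `|cosn n (a + b) - \sum_(j < m) cosn (n + j) a * (b ^+ j / j`!%:R)|
    <= b ^+ m / m`!%:R.
Proof.
elim: m n b => [|m IH] n b b0.
  by rewrite big_ord0 subr0 expr0 invr1 mulr1 cosn_norm_le1.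
pose r k l (y : R) : R :=
  cosn l (a + y) - \sum_(j < k) cosn (l + j) a * (y ^+ j / j`!%:R).
pose q k (y : R) : R := y ^+ k / k`!%:R.
have dq k (y : R) : is_derive y 1 (q k.+1) (q k y).
  have -> : q k.+1 = (k.+1`!%:R)^-1 \*: (id ^+ k.+1 : R -> R).
    by apply/funext => z; rewrite /q exprfctE /= mulrC.
  apply: is_derive_eq; rewrite /= /q factS natrM.
  have : k.+1%:R != 0 :> R by rewrite pnatr_eq0.
  have : k`!%:R != 0 :> R by rewrite pnatr_eq0 -lt0n fact_gt0.
  rewrite !scaler1 /GRing.scale/= => ? ?. by field; apply/andP.
have dr l (y : R) : is_derive y 1 (r m.+1 l) (r m l.+1 y).
  have -> : r m.+1 l = (fun y => cosn l (a + y)) -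
      (cst (cosn l a) + \sum_(j < m) cosn (l + j.+1) a \*: q j.+1).
    apply/funext => z; rewrite /r/= big_ord_recl addn0 expr0 invr1 !mulr1.
    by congr (_ - (_ + _)); rewrite fct_sumE.
  have D1 := is_derive_cosn l a y.
  have D2 : is_derive y 1 (\sum_(j < m) cosn (l + j.+1) a \*: q j.+1)
      (\sum_(j < m) cosn (l + j.+1) a *: q j y).
    by apply: is_derive_sum => j; apply: is_deriveZ; exact: dq.
  have D3 := is_deriveB D1 (is_deriveD (is_derive_cst (cosn l a) y 1) D2).
  apply: (is_derive_eq D3); rewrite add0r /r; congr (_ - _).
  by apply: eq_bigr => i _; rewrite addnS addSn.
have h0 l : r m.+1 l 0 = 0.
  rewrite /r big_ord_recl big1; last first.
    by move=> i _; rewrite expr0n /= mul0r mulr0.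
  by rewrite addr0 expr0 invr1 addn0 !mulr1 addr0 subrr.
have q0 : q m.+1 0 = 0 by rewrite /q expr0n mul0r.
have qN (y : R) : is_derive y 1 (- q m.+1) (- q m y) by exact: is_deriveN.
have main1 : r m.+1 n b <= q m.+1 b.
  apply: (le_of_derive_le (dr n) (dq m)) => // [|x x0].
    by rewrite h0 q0.
  by have := IH n.+1 x x0; rewrite ler_norml => /andP[].
have main2 : (- q m.+1) b <= r m.+1 n b.
  apply: (le_of_derive_le qN (dr n)) => // [|x x0].
    by rewrite h0 opprfctE q0 oppr0.
  by have := IH n.+1 x x0; rewrite ler_norml => /andP[].
by rewrite ler_norml; apply/andP.
Qed.

(** Bang's proof of the quasi-analyticity theorem. The function [f n] plays the
    role of the [n]-th derivative of [f 0]; only the Taylor estimates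
    are used, so differentiability need not be mentioned. *)
Section Bang.
Context (R : realType) (M : nat -> R) (f : nat -> R -> R).
Hypothesis M_gt0 : forall n, 0 < M n.
Hypothesis M_convex : forall n, M n.+1 ^+ 2 <= M n * M n.+2.
Hypothesis f_le : forall n s, `|f n s| <= M n.
Hypothesis f_taylor : forall m n (s h : R), 0 <= h ->
  `|f n (s + h) - \sum_(j < m) f (n + j)%N s * (h ^+ j / j`!%:R)|
    <= M (n + m)%N * (h ^+ m / m`!%:R).
Hypothesis f_flat : forall n, f n 0 = 0.

Let M_ge0 n : 0 <= M n. Proof. exact: ltW. Qed.

Let e_ge0 : 0 <= expR 1 :> R. Proof. exact: expR_ge0. Qed.

Let M_ratio n m : (n <= m)%N -> M n.+1 / M n <= M m.+1 / M m.
Proof.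
elim: m => [|m IH]; first by rewrite leqn0 => /eqP ->.
rewrite leq_eqVlt => /predU1P[->//|nm].
apply: (le_trans (IH nm)).
rewrite ler_pdivrMr// mulrAC ler_pdivlMr// -expr2 mulrC; exact: M_convex.
Qed.

Let M_shift k n j : (n + j <= k.+1)%N ->
  M (n + j)%N <= M n * (M k.+1 / M k) ^+ j.
Proof.
elim: j => [|j IH] nj; first by rewrite addn0 expr0 mulr1.
have /M_ratio r : (n + j <= k)%N by rewrite -ltnS -addnS.
rewrite addnS in nj *; have {}IH := IH (ltnW nj).
rewrite exprSr mulrA.
apply: le_trans (ler_pM _ _ IH r).
- by rewrite mulrCA divff ?mulr1// gt_eqF.
- exact: ltW.
- by rewrite divr_ge0.
Qed.

Let reach k K : R := (expR 1)^-1 * \sum_(k <= n < K) M n / M n.+1.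

(** The idea of Bang: at the flat point 0 every derivative satisfies the bound
    with the factor exp(n - K) for any [K], and a step to the right of
    length at most M_k / (e M_{k+1}) costs one factor e, because
    log-convexity makes the Taylor expansion up to order [k.+1] at most a
    partial sum of the exponential series of argument 1. Orders above [k] need
    no argument, as there the factor is at least 1. *)
Lemma bang_propagation k K (s : R) : (k <= K)%N -> 0 <= s <= reach k K ->
  forall n, `|f n s| <= expR 1 ^+ n / expR 1 ^+ k * M n.
Proof.
have e0 : 0 < expR 1 :> R by exact: expR_gt0.
have e1 : 1 <= expR 1 :> R by rewrite -[leLHS]expR0 ler_expR.
move=> kK; move: s; rewrite -(subKn kK); move: (K - k)%N (leq_subr k K) => d.
elim: d => [|d IH] dK s sr n.
  move: sr; rewrite subn0 /reach big_geq// mulr0 => /le_anti <-.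
  by rewrite f_flat normr0 mulr_ge0 ?ltW// divr_ge0// exprn_ge0.
set k' := (K - d.+1)%N; have k'S : (K - d)%N = k'.+1 by rewrite /k' -subSn.
have {}IH := IH (ltnW dK); rewrite k'S in IH.
have k'K : (k' < K)%N by rewrite /k' ltn_subrL/= (leq_ltn_trans _ dK).
have [k'n|nk'] := leqP k'.+1 n.
  apply: (le_trans (f_le n s)); rewrite ler_peMl //.
  rewrite ler_pdivlMr ?exprn_gt0// mul1r ler_weXn2l// ltnW//.
(* The last step towards [s]; if [s] is already in reach of one step from 0,
   the step is [s] itself. *)
pose h := Num.min s ((expR 1)^-1 * (M k' / M k'.+1)).
have h0 : 0 <= h.
  rewrite /h le_min; case/andP: sr => -> _ /=.
  by rewrite mulr_ge0 ?invr_ge0 ?divr_ge0.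
have hle : h <= (expR 1)^-1 * (M k' / M k'.+1) by rewrite /h ge_min lexx orbT.
have s'r : 0 <= s - h <= reach k'.+1 K.
  rewrite subr_ge0 /h ge_min lexx/=.
  case/andP: sr => s0; rewrite /reach big_ltn// mulrDr => sr.
  rewrite lerBlDl /Num.min; case: ifPn => // _.
  rewrite lerDl mulr_ge0 ?invr_ge0// sumr_ge0// => i _.
  by rewrite divr_ge0.
have := f_taylor (k'.+1 - n) n (s - h) h0; rewrite subrK.
rewrite subnKC ?(ltnW nk')// => T.
set m := (k'.+1 - n)%N in T *.
have step j : (j <= m)%N ->
    expR 1 ^+ (n + j) / expR 1 ^+ k'.+1 * M (n + j)%N * (h ^+ j / j`!%:R) <=
    expR 1 ^+ n / expR 1 ^+ k'.+1 * M n * (j`!%:R)^-1.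
  move=> jm.
  have Mj : M (n + j)%N <= M n * (M k'.+1 / M k') ^+ j.
    by apply: M_shift; rewrite -(subnKC (ltnW nk')) leq_add2l.
  have hj : h ^+ j <= ((expR 1)^-1 * (M k' / M k'.+1)) ^+ j.
    by rewrite lerXn2r// nnegrE// mulr_ge0 ?invr_ge0 ?divr_ge0.
  rewrite mulrA ler_wpM2r ?invr_ge0//.
  rewrite exprD -!mulrA ler_wpM2l ?exprn_ge0//.
  rewrite [leLHS](_ : _ = (expR 1 ^+ k'.+1)^-1 *
    (expR 1 ^+ j * (M (n + j)%N * h ^+ j))); last by ring.
  rewrite ler_wpM2l ?invr_ge0 ?exprn_ge0//.
  apply: le_trans (_ : expR 1 ^+ j * ((M n * (M k'.+1 / M k') ^+ j) *
      ((expR 1)^-1 * (M k' / M k'.+1)) ^+ j) <= _).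
    by rewrite ler_wpM2l ?exprn_ge0// ler_pM ?exprn_ge0.
  rewrite -mulrA -exprMn mulrCA -exprMn.
  rewrite [X in X ^+ j](_ : _ = 1) ?expr1n ?mulr1//.
  by field; rewrite !gt_eqF.
have -> : `|f n s| = `|(f n s - \sum_(j < m) f (n + j)%N (s - h) *
  (h ^+ j / j`!%:R)) + \sum_(j < m) f (n + j)%N (s - h) * (h ^+ j / j`!%:R)|.
  by rewrite subrK.
apply: (le_trans (ler_normD _ _)).
have S : `|\sum_(j < m) f (n + j)%N (s - h) * (h ^+ j / j`!%:R)| <=
  \sum_(j < m) expR 1 ^+ n / expR 1 ^+ k'.+1 * M n * (j`!%:R)^-1.
  apply: (le_trans (ler_norm_sum _ _ _)); apply: ler_sum => j _.
  apply: le_trans (step j (ltnW (ltn_ord j))).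
  have hj0 : 0 <= h ^+ j / j`!%:R by rewrite divr_ge0// exprn_ge0.
  by rewrite normrM (ger0_norm hj0) ler_wpM2r// IH.
have T' : M k'.+1 * (h ^+ m / m`!%:R) <=
    expR 1 ^+ n / expR 1 ^+ k'.+1 * M n * (m`!%:R)^-1.
  apply: le_trans (step m (leqnn _)).
  by rewrite /m subnKC ?(ltnW nk')// divff ?mul1r// gt_eqF// exprn_gt0.
apply: (le_trans (lerD (le_trans T T') S)).
rewrite addrC -(big_ord_recr m (fun j => expR 1 ^+ n / expR 1 ^+ k'.+1 * M n *
  (j`!%:R)^-1)) /= -mulr_sumr.
apply: le_trans (ler_wpM2l _ (sum_inv_fact_le R m.+1)) _.
  by rewrite mulr_ge0// divr_ge0// exprn_ge0.
rewrite exprS invfM le_eqVlt; apply/orP; left; apply/eqP.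
by field; rewrite !gt_eqF ?exprn_gt0.
Qed.

Theorem bang_vanishing :
  (forall A : R, exists K, A <= \sum_(0 <= n < K) M n / M n.+1) ->
  forall s : R, 0 <= s -> f 0%N s = 0.
Proof.
move=> Mdiv s s0; apply/eqP; rewrite -normr_le0.
have key k : `|f 0%N s| <= expR (- k%:R) * M 0%N.
  have [K HK] := Mdiv (\sum_(0 <= n < k) M n / M n.+1 + expR 1 * s).
  have kK : (k <= K)%N.
    rewrite leqNgt; apply/negP => Kk; move: HK.
    rewrite [X in X + _](@big_cat_nat _ _ _ K)//=; last exact: ltnW.
    rewrite -addrA gerDl leNgt => /negP; apply.
    rewrite big_ltn// ltr_pwDl ?mulr_ge0// ltr_pwDl ?divr_gt0//.
    by rewrite sumr_ge0// => i _; rewrite divr_ge0.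
  have /bang_propagation - /(_ kK 0%N) : 0 <= s <= reach k K.
    rewrite s0/= /reach mulrC ler_pdivlMr ?expR_gt0// mulrC.
    by move: HK; rewrite [X in _ <= X](@big_cat_nat _ _ _ k)//= lerD2l.
  by rewrite expr0 div1r -expRM_natl mulr1 expRN.
have : (fun k => expR (- k%:R) * M 0%N) @ \oo --> 0 * M 0%N.
  by apply: cvgM; [exact: cvgn_expR|exact: cvg_cst].
rewrite mul0r => cv; rewrite -(cvg_lim _ cv)//.
by apply: limr_ge; [apply/cvg_ex; eexists; exact: cv|exact: nearW].
Qed.

End Bang.

(** * Carleman's inequality *)

Section CarlemanInequality.
Context (R : realType) (a : nat -> R).
Hypothesis a_ge0 : forall k, 0 <= a k.

Let c (k : nat) : R := k.+2%:R ^+ k.+1 / k.+1%:R ^+ k.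

Let c_ge0 k : 0 <= c k.
Proof. by rewrite divr_ge0// exprn_ge0. Qed.

Let prod_c n : \prod_(k < n) c k = n.+1%:R ^+ n.
Proof.
elim: n => [|n IH]; first by rewrite big_ord0 expr0.
by rewrite big_ord_recr/= IH /c mulrC divfK// expf_neq0// pnatr_eq0.
Qed.

Let c_le k : c k / k.+1%:R <= expR 1.
Proof.
rewrite /c -mulrA -invfM -exprSr -expr_div_n.
have -> : k.+2%:R / k.+1%:R = 1 + k.+1%:R^-1 :> R.
  by rewrite -[k.+2%:R]natr1 mulrDl divff ?mul1r// pnatr_eq0.
have -> : expR 1 = expR (k.+1%:R^-1) ^+ k.+1 :> R.
  by rewrite -expRM_natl divff// pnatr_eq0.
by rewrite lerXn2r ?nnegrE ?expR_ge0 ?addr_ge0 ?invr_ge0// expR_ge1Dx.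
Qed.

Let S n := \sum_(k < n) c k * a k.

Let geometric_mean_le n :
  (\prod_(k < n.+1) a k) `^ n.+1%:R^-1 <= S n.+1 / (n.+1%:R * n.+2%:R).
Proof.
have S0 : 0 <= S n.+1 by apply: sumr_ge0 => i _; exact: mulr_ge0.
have P0 : 0 <= \prod_(k < n.+1) a k by exact: prodr_ge0.
have := @leif_AGM R 'I_n.+1 predT (fun k => c k * a k).
move=> /(_ (fun i _ => mulr_ge0 (c_ge0 _) (a_ge0 _))) [+ _].
rewrite cardT size_enum_ord big_split/= prod_c => H.
have {}H : \prod_(k < n.+1) a k <= (S n.+1 / (n.+1%:R * n.+2%:R)) ^+ n.+1.
  rewrite invfM mulrA [X in _ <= X ^+ _]mulrC exprMn.
  by rewrite exprVn mulrC ler_pdivlMr ?exprn_gt0// mulrC.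
apply: (@le_trans _ _ (((S n.+1 / (n.+1%:R * n.+2%:R)) ^+ n.+1) `^ n.+1%:R^-1)).
  by rewrite ge0_ler_powR ?nnegrE ?exprn_ge0 ?divr_ge0 ?mulr_ge0 ?invr_ge0.
by rewrite -powR_mulrn ?divr_ge0 ?mulr_ge0// -powRrM divff ?pnatr_eq0// powRr1 ?divr_ge0 ?mulr_ge0.
Qed.

Let telescope N : \sum_(n < N) S n.+1 / (n.+1%:R * n.+2%:R) =
  \sum_(k < N) c k * a k * (k.+1%:R^-1 - N.+1%:R^-1).
Proof.
elim: N => [|N IH]; first by rewrite !big_ord0.
have E : (N.+1%:R * N.+2%:R)^-1 = N.+1%:R^-1 - N.+2%:R^-1 :> R.
  rewrite -[N.+2%:R]natr1.
  have : N.+1%:R != 0 :> R by rewrite pnatr_eq0.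
  have : N.+1%:R + 1 != 0 :> R by rewrite natr1 pnatr_eq0.
  by move=> ? ?; field; apply/andP.
rewrite big_ord_recr/= IH E /S mulr_suml !big_ord_recr/= addrA -big_split/=.
by congr (_ + _); apply: eq_bigr => k _; rewrite -mulrDr; congr (_ * _); ring.
Qed.

(** The weights [c k] have product [n.+1] ^ n, so the arithmetic-geometric mean
    inequality for the numbers [c k * a k] bounds the geometric mean by
    the sum of the [c k * a k] divided by n (n + 1); these coefficients
    telescope, and [c k] is at most e (k + 1). *)
Theorem carleman_inequality N :
  \sum_(n < N) (\prod_(k < n.+1) a k) `^ n.+1%:R^-1 <=
  expR 1 * \sum_(k < N) a k.
Proof.
apply: (@le_trans _ _ (\sum_(n < N) S n.+1 / (n.+1%:R * n.+2%:R))).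
  by apply: ler_sum => n _; exact: geometric_mean_le.
rewrite telescope mulr_sumr; apply: ler_sum => k _.
rewrite mulrAC ler_wpM2r//; apply: le_trans (c_le k).
by rewrite ler_wpM2l// gerBl.
Qed.

End CarlemanInequality.

Definition carleman_divergent (R : realType) (g : nat -> R) : Prop :=
  forall A : R, exists N, A <= \sum_(1 <= n < N) g n `^ (- n.*2%:R^-1).

(** The numbers M_n^(-1/n) are, up to a constant, the geometric means of the
    ratios M_k / M_{k+1}. It is enough that the even terms diverge, which is
    all that the moments of a measure on the half-line give. *)
Lemma ratio_divergence (R : realType) (M : nat -> R) :
  (forall n, 0 < M n) -> carleman_divergent (fun n => M n.*2) ->
  forall A : R, exists K, A <= \sum_(0 <= n < K) M n / M n.+1.
Proof.
move=> M_gt0 Mdiv A.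
pose a k := M k / M k.+1.
have a_ge0 k : 0 <= a k by rewrite divr_ge0// ltW.
pose C := Num.min 1 (M 0%N).
have C_gt0 : 0 < C by rewrite lt_min ltr01 M_gt0.
have prod_a n : \prod_(k < n) a k = M 0%N / M n.
  elim: n => [|n IH]; first by rewrite big_ord0 divff// gt_eqF.
  rewrite big_ord_recr/= IH /a.
  have := gt_eqF (M_gt0 n); have := gt_eqF (M_gt0 n.+1) => /negbT ? /negbT ?.
  by field; apply/andP.
pose G n : R := M n `^ (- n%:R^-1).
have G_le n : C * G n.+1 <= (\prod_(k < n.+1) a k) `^ n.+1%:R^-1.
  have Mn0 := ltW (M_gt0 n.+1).
  rewrite prod_a powRM ?invr_ge0 ?(ltW (M_gt0 _))//.
  rewrite -[(M n.+1)^-1]powR_inv1// -powRrM mulN1r.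
  rewrite ler_wpM2r ?powR_ge0//.
  have C_le1 : C <= 1 by rewrite ge_min lexx.
  apply: (@le_trans _ _ (C `^ n.+1%:R^-1)).
    by apply: ger1_powR; rewrite ?C_gt0// invf_le1// ler1n.
  by rewrite ge0_ler_powR ?nnegrE ?(ltW C_gt0) ?(ltW (M_gt0 _))// ge_min lexx orbT.
have G0 n : 0 <= G n by exact: powR_ge0.
have even_le N : \sum_(1 <= n < N.+1) G n.*2 <= \sum_(n < N.*2) G n.+1.
  elim: N => [|N IH]; first by rewrite big_geq// big_ord0.
  rewrite big_nat_recr// [X in _ <= X](_ : _ = \sum_(n < N.*2) G n.+1 +
    G N.*2.+1 + G N.*2.+2); last by rewrite doubleS 2!big_ord_recr.
  by rewrite lerD// (le_trans IH)// lerDl.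
have [N HN] := Mdiv (A * expR 1 / C).
exists N.*2.
have := carleman_inequality a_ge0 N.*2.
rewrite -ler_pdivrMl ?expR_gt0// big_mkord; apply: le_trans.
rewrite ler_pdivlMl ?expR_gt0// mulrC.
apply: (@le_trans _ _ (\sum_(n < N.*2) C * G n.+1)); last exact: ler_sum.
rewrite ler_pdivrMr// in HN; apply: (le_trans HN).
rewrite -mulr_sumr mulrC ler_wpM2l ?(ltW C_gt0)//; case: N {HN} => [|N].
  by rewrite big_geq// sumr_ge0.
by rewrite (le_trans (even_le N))// doubleS 2!big_ord_recr/= -addrA lerDl addr_ge0.
Qed.

(** * Moments of half-integral order *)

Section RealIntegrable.
Context d (T : measurableType d) (R : realType).
Context (mu : {measure set T -> \bar R}) (D : set T) (mD : measurable D).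
Implicit Types f g : T -> R.

Lemma integrableZl_EFin (c : R) f : mu.-integrable D (EFin \o f) ->
  mu.-integrable D (EFin \o (fun t => c * f t)).
Proof.
move=> fi; rewrite (_ : _ \o _ = fun t => (c%:E * (EFin \o f) t)%E) //.
exact: integrableZl.
Qed.

Lemma integrableZr_EFin (c : R) f : mu.-integrable D (EFin \o f) ->
  mu.-integrable D (EFin \o (fun t => f t * c)).
Proof.
move=> fi; rewrite (_ : _ \o _ = fun t => ((EFin \o f) t * c%:E)%E) //.
exact: integrableZr.
Qed.

Lemma integrableD_EFin f g : mu.-integrable D (EFin \o f) ->
  mu.-integrable D (EFin \o g) ->
  mu.-integrable D (EFin \o (fun t => f t + g t)).
Proof.
move=> fi gi.
rewrite (_ : _ \o _ = fun t => ((EFin \o f) t + (EFin \o g) t)%E) //.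
exact: integrableD.
Qed.

Lemma integrableB_EFin f g : mu.-integrable D (EFin \o f) ->
  mu.-integrable D (EFin \o g) ->
  mu.-integrable D (EFin \o (fun t => f t - g t)).
Proof.
move=> fi gi.
rewrite (_ : _ \o _ = fun t => ((EFin \o f) t - (EFin \o g) t)%E) //.
exact: integrableB.
Qed.

Lemma Rintegral_sum (I : Type) (r : seq I) (F : I -> T -> R) :
  (forall i, mu.-integrable D (EFin \o F i)) ->
  \int[mu]_(t in D) (\sum_(i <- r) F i t) =
  \sum_(i <- r) \int[mu]_(t in D) F i t /\
  mu.-integrable D (EFin \o (fun t => \sum_(i <- r) F i t)).
Proof.
move=> iF; elim: r => [|i r [IH1 IH2]].
  rewrite big_nil; split.
    under eq_Rintegral do rewrite big_nil.
    by rewrite Rintegral_cst// mul0r.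
  rewrite (_ : _ \o _ = cst 0%E) ?integrable0//.
  by apply/funext => t /=; rewrite big_nil.
have E : (fun t => \sum_(j <- i :: r) F j t) =
    (fun t => F i t + \sum_(j <- r) F j t).
  by apply/funext => t; rewrite big_cons.
by rewrite E big_cons -IH1 -RintegralD//; split => //; exact: integrableD_EFin.
Qed.

End RealIntegrable.

Lemma measurable_cosn (R : realType) n (s : R) :
  measurable_fun setT (fun t : R => cosn n (s * Num.sqrt t)).
Proof.
have mc : measurable_fun setT (@cos R).
  by apply: continuous_measurable_fun => x; exact: continuous_cos.
rewrite /cosn; apply: measurableT_comp; first exact: mc.
apply: measurable_funD; last exact: measurable_cst.
apply: measurable_funM; first exact: measurable_cst.
by apply: continuous_measurable_fun => x; exact: sqrt_continuous.
Qed.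

Lemma measurable_sqrtX (R : realType) n :
  measurable_fun setT (fun t : R => Num.sqrt t ^+ n).
Proof.
apply: measurable_funX.
by apply: continuous_measurable_fun => x; exact: sqrt_continuous.
Qed.

Section HalfMoments.
Context (R : realType) (nu : {measure set (measurableTypeR R) -> \bar R}).
Hypothesis moments : forall n, 
  (\int[nu]_(t in `[0%R, +oo[%classic) (t ^+ n)%:E < +oo)%E.
Let D : set R := `[0%R, +oo[%classic.
Let mD : measurable (D : set (measurableTypeR R)).
Proof. exact: measurable_itv. Qed.

Let D_ge0 t : D t -> 0 <= t.
Proof. by rewrite /D/= in_itv/= andbT. Qed.

Lemma integrable_moment n : nu.-integrable D (fun t => (t ^+ n)%:E).
Proof.
apply/integrableP; split.
  apply/measurable_EFinP; apply: measurable_funTS; exact: measurable_funX.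
under eq_integral => t /set_mem/D_ge0 t0 do rewrite /= ger0_norm ?exprn_ge0//.
exact: moments.
Qed.

Lemma finite_half_line : (nu D < +oo)%E.
Proof.
have := moments 0; under eq_integral do rewrite expr0.
by rewrite integral_cst// mul1e.
Qed.

Lemma integrable_sqrtX n : nu.-integrable D (fun t => (Num.sqrt t ^+ n)%:E).
Proof.
apply: (@le_integrable _ _ _ _ _ mD _ (fun t => (1 + t ^+ n)%:E)).
- by apply/measurable_EFinP; apply: measurable_funTS; exact: measurable_sqrtX.
- move=> t /D_ge0 t0; rewrite /= lee_fin !ger0_norm ?exprn_ge0 ?sqrtr_ge0//.
    have [t1|t1] := leP t 1.
      by rewrite ler_wpDr ?exprn_ge0// exprn_ile1 ?sqrtr_ge0// -sqrtr1 ler_wsqrtr.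
    rewrite ler_wpDl// lerXn2r ?nnegrE ?sqrtr_ge0//.
    rewrite -[leRHS]ger0_norm// -sqrtr_sqr ler_wsqrtr// expr2.
    by rewrite ler_peMl// ltW.
  by rewrite addr_ge0 ?exprn_ge0.
- under eq_fun do rewrite EFinD.
  apply: integrableD => //; last exact: integrable_moment.
  have -> : (fun=> 1%:E) = (fun t : R => (t ^+ 0)%:E).
    by apply/funext => t; rewrite expr0.
  exact: integrable_moment.
Qed.

Lemma integrable_sqrtX_cosn n k (s : R) :
  nu.-integrable D (fun t => (Num.sqrt t ^+ n * cosn k (s * Num.sqrt t))%:E).
Proof.
apply: (le_integrable mD _ _ (integrable_sqrtX n)).
  apply/measurable_EFinP; apply: measurable_funTS.
  by apply: measurable_funM; [exact: measurable_sqrtX|exact: measurable_cosn].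
by move=> t _; rewrite /= lee_fin normrM ler_piMr// cosn_norm_le1.
Qed.

(** The moment of order [n / 2] of [nu]. *)
Definition half_moment n : R := \int[nu]_(t in D) (Num.sqrt t ^+ n).

(** The [n]-th derivative at [s] of the integral of cos(s sqrt t). *)
Definition cos_moment n (s : R) : R :=
  \int[nu]_(t in D) (Num.sqrt t ^+ n * cosn n (s * Num.sqrt t)).

Lemma half_moment_ge0 n : 0 <= half_moment n.
Proof. by apply: Rintegral_ge0 => t _; rewrite exprn_ge0 ?sqrtr_ge0. Qed.

Lemma half_moment_double n : half_moment n.*2 = \int[nu]_(t in D) (t ^+ n).
Proof.
apply: eq_Rintegral => t /set_mem/D_ge0 t0.
by rewrite -mul2n exprM sqr_sqrtr.
Qed.

(** This is the positivity of the integral of sqrt(t)^n (l - sqrt t)^2. It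
    contains the log-convexity of the moments and, unlike it, remains
    informative when a moment vanishes. *)
Lemma half_moment_quadratic n (l : R) :
  2 * l * half_moment n.+1 <= l ^+ 2 * half_moment n + half_moment n.+2.
Proof.
rewrite /half_moment -!RintegralZl//; try exact: integrable_sqrtX.
have i1 c k : nu.-integrable D (EFin \o (fun t => c * Num.sqrt t ^+ k)).
  by apply: integrableZl_EFin => //; exact: integrable_sqrtX.
rewrite -RintegralD//; try exact: integrable_sqrtX.
apply: le_Rintegral => //.
  by apply: integrableD_EFin => //; exact: integrable_sqrtX.
move=> t _; rewrite !exprS -subr_ge0.
have -> : l * (l * 1) * Num.sqrt t ^+ n + Num.sqrt t * (Num.sqrt t * Num.sqrt t ^+ n)
    - 2 * l * (Num.sqrt t * Num.sqrt t ^+ n) = Num.sqrt t ^+ n * (l - Num.sqrt t) ^+ 2.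
  by ring.
by apply: mulr_ge0; [rewrite exprn_ge0// sqrtr_ge0|exact: sqr_ge0].
Qed.

Lemma cos_moment_le n s : `|cos_moment n s| <= half_moment n.
Proof.
apply: (le_trans (le_normr_Rintegral mD (integrable_sqrtX_cosn n n s))).
apply: le_Rintegral => //.
- exact: integrable_norm (integrable_sqrtX_cosn n n s).
- exact: integrable_sqrtX.
- move=> t _; rewrite normrM ger0_norm ?exprn_ge0 ?sqrtr_ge0//.
  by rewrite ler_piMr ?exprn_ge0 ?sqrtr_ge0// cosn_norm_le1.
Qed.

Lemma cos_moment_taylor m n (s h : R) : 0 <= h ->
  `|cos_moment n (s + h) - \sum_(j < m) cos_moment (n + j) s * (h ^+ j / j`!%:R)|
    <= half_moment (n + m) * (h ^+ m / m`!%:R).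
Proof.
move=> h0.
have iF (j : 'I_m) : nu.-integrable D (EFin \o (fun t =>
    Num.sqrt t ^+ (n + j) * cosn (n + j) (s * Num.sqrt t) * (h ^+ j / j`!%:R))).
  by apply: integrableZr_EFin => //; exact: integrable_sqrtX_cosn.
have [Esum isum] := Rintegral_sum mD (index_enum 'I_m) iF.
have -> : \sum_(j < m) cos_moment (n + j) s * (h ^+ j / j`!%:R) =
    \sum_(j < m) \int[nu]_(t in D) (Num.sqrt t ^+ (n + j) *
      cosn (n + j) (s * Num.sqrt t) * (h ^+ j / j`!%:R)).
  apply: eq_bigr => j _; rewrite /cos_moment -RintegralZr//.
  exact: integrable_sqrtX_cosn.
have idiff : nu.-integrable D (EFin \o (fun t =>
    Num.sqrt t ^+ n * cosn n ((s + h) * Num.sqrt t) -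
    \sum_(j < m) Num.sqrt t ^+ (n + j) *
      cosn (n + j) (s * Num.sqrt t) * (h ^+ j / j`!%:R))).
  by apply: integrableB_EFin => //; exact: integrable_sqrtX_cosn.
rewrite -Esum /cos_moment -RintegralB//; last exact: integrable_sqrtX_cosn.
apply: (le_trans (le_normr_Rintegral mD idiff)).
rewrite /half_moment -RintegralZr//; last exact: integrable_sqrtX.
apply: le_Rintegral => //; first exact: integrable_norm idiff.
  by apply: integrableZr_EFin => //; exact: integrable_sqrtX.
move=> t _; set x := Num.sqrt t.
have x0 : 0 <= x by exact: sqrtr_ge0.
have := cosn_taylor m n (s * x) (mulr_ge0 h0 x0).
rewrite -mulrDl => T.
have := ler_wpM2l (exprn_ge0 n x0) T.
rewrite -{1}[x ^+ n]ger0_norm ?exprn_ge0// -normrM mulrBr mulr_sumr.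
have -> : x ^+ n * ((h * x) ^+ m / m`!%:R) = x ^+ (n + m) * (h ^+ m / m`!%:R).
  by rewrite exprMn exprD; ring.
congr (`|_ - _| <= _); apply: eq_bigr => j _.
by rewrite exprMn exprD; ring.
Qed.

End HalfMoments.

(** * Cosine transforms and determinacy *)

Lemma cvg_of_le_harmonic (R : realType) (u : nat -> R) (l K : R) :
  (forall n, `|u n - l| <= K / n.+1%:R) -> u @ \oo --> l.
Proof.
move=> uK.
have hK : (fun n => K / n.+1%:R) @ \oo --> (0 : R).
  by rewrite -(mulr0 K); apply: cvgM; [exact: cvg_cst|exact: cvg_harmonic].
apply: (@squeeze_cvgr _ _ _ _ (fun n => l - K / n.+1%:R) (fun n => l + K / n.+1%:R)).
- by apply: nearW => n; have := uK n; rewrite ler_distl.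
- by rewrite -[X in _ --> X]subr0; apply: cvgB => //; exact: cvg_cst.
- by rewrite -[X in _ --> X]addr0; apply: cvgD => //; exact: cvg_cst.
Qed.

Lemma dist_exprn_le (R : realType) (a b : R) n : `|a| <= 1 -> `|b| <= 1 ->
  `|a ^+ n - b ^+ n| <= n%:R * `|a - b|.
Proof.
move=> a1 b1; elim: n => [|n IH]; first by rewrite !expr0 subrr normr0 mul0r.
have -> : a ^+ n.+1 - b ^+ n.+1 = a * (a ^+ n - b ^+ n) + (a - b) * b ^+ n.
  by rewrite !exprS; ring.
apply: (le_trans (ler_normD _ _)); rewrite -[n.+1%:R]natr1.
rewrite [leRHS]mulrDl mul1r lerD//.
  by rewrite normrM (le_trans _ IH)// ler_piMl.
by rewrite normrM normrX ler_piMr// exprn_ile1.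
Qed.

(** Both sides are [n]-th powers of numbers of modulus at most 1, and the
    fourth-order Taylor polynomial of cos u agrees with exp(- u^2 / 2) up to
    u^4. *)
Lemma cosX_expR (R : realType) n (u : R) : 0 <= u ->
  `|cos u ^+ n - expR (- (n%:R * (u ^+ 2 / 2)))| <= n%:R * u ^+ 4.
Proof.
move=> u0; rewrite -mulrN expRM_natl.
set v := u ^+ 2 / 2; have v0 : 0 <= v by rewrite divr_ge0// exprn_ge0.
have e1 : expR (- v) <= 1 by rewrite expR_le1 oppr_le0.
apply: le_trans (dist_exprn_le _ _ _) _; first exact: cos_max.
  by rewrite ger0_norm ?expR_ge0.
rewrite ler_wpM2l//.
have c0 y : cosn 0 y = cos y :> R by rewrite /cosn mul0r addr0.
have c1 : cosn 1 0 = 0 :> R by rewrite /cosn add0r mul1r cos_pihalf.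
have c2 : cosn 2 0 = -1 :> R.
  by rewrite /cosn add0r (_ : 2 * (pi / 2) = pi) ?cospi//; field.
have c3 : cosn 3 0 = 0 :> R.
  rewrite /cosn add0r (_ : 3 * (pi / 2) = pi + pi / 2); last by field.
  by rewrite cosDpihalf sinpi oppr0.
have := cosn_taylor 4 0 0 u0.
rewrite !big_ord_recr big_ord0 /= !add0n !c0 c1 c2 c3 cos0 !add0r.
rewrite expr0 !mul0r !addr0 mulN1r mul1r fact0 invr1 mulr1.
have -> : u ^+ 2 / 2`!%:R = v by [].
have -> : 4`!%:R = 24 :> R by [].
move=> /ler_normlP[d1 d2].
have e2 : 1 - v <= expR (- v) by rewrite expR_ge1Dx.
have e3 : expR (- v) <= 1 - v + v ^+ 2.
  rewrite expRN -div1r ler_pdivrMr ?expR_gt0//.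
  apply: (@le_trans _ _ ((1 - v + v ^+ 2) * (1 + v))).
    rewrite (_ : _ * _ = 1 + v ^+ 3); last by ring.
    by rewrite lerDl exprn_ge0.
  rewrite ler_wpM2l ?expR_ge1Dx//.
  have : 0 <= (v - 2^-1) ^+ 2 by exact: sqr_ge0.
  by rewrite expr2 => ?; nra.
have v2 : v ^+ 2 = u ^+ 4 / 4 by rewrite /v; field.
have u4 : 0 <= u ^+ 4 by rewrite exprn_ge0.
rewrite v2 in e3.
rewrite ler_norml; apply/andP; split; lra.
Qed.

Lemma bernoulli_le (R : realType) (x : R) n : 0 <= x <= 1 ->
  1 - n%:R * x <= (1 - x) ^+ n.
Proof.
move=> /andP[x0 x1]; elim: n => [|n IH]; first by rewrite mul0r subr0.
have y0 : 0 <= 1 - x by rewrite subr_ge0.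
rewrite exprS; apply: le_trans (ler_wpM2l y0 IH).
rewrite -[n.+1%:R]natr1; have : 0 <= n%:R * x ^+ 2 by rewrite mulr_ge0// exprn_ge0.
rewrite expr2; nra.
Qed.

(** The exponent [N] lies between n exp(n a) and n exp(n a) + 1, so that
    N exp(- n t) tends to infinity for t <= a, including t = a, and to 0 for
    t > a. The power behaves like exp(- N exp(- n t)). *)
Lemma one_sub_expRX_cvg0 (R : realType) (a t : R) : t <= a -> 0 <= t ->
  (1 - expR (- (n.+1%:R * t))) ^+
    (Num.truncn (n.+1%:R * expR (n.+1%:R * a))).+1 @[n --> \oo] --> (0 : R).
Proof.
move=> ta t0; apply: (@cvg_of_le_harmonic _ _ _ 1) => n; rewrite subr0 div1r.
set N := (Num.truncn _).+1; set x := expR (- (n.+1%:R * t)).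
have x0 : 0 < x by exact: expR_gt0.
have x1 : x <= 1 by rewrite expR_le1 oppr_le0 mulr_ge0.
rewrite ger0_norm ?exprn_ge0 ?subr_ge0//.
apply: (@le_trans _ _ (expR (- x) ^+ N)).
  rewrite lerXn2r ?nnegrE ?expR_ge0 ?subr_ge0// expR_ge1Dx//.
rewrite -expRM_natl mulrN expRN lef_pV2 ?posrE ?expR_gt0//.
apply: le_trans (expR_ge1Dx _); rewrite -[leLHS]add0r lerD//.
apply: (@le_trans _ _ (n.+1%:R * expR (n.+1%:R * a) * x)).
  rewrite -mulrA ler_peMr// /x -expRD -{1}expR0 ler_expR -mulrBr.
  by rewrite mulr_ge0// subr_ge0.
by rewrite ler_wpM2r ?(ltW x0)// (ltW (truncnS_gt _)).
Qed.

Lemma one_sub_expRX_cvg1 (R : realType) (a t : R) : a < t -> 0 <= a ->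
  (1 - expR (- (n.+1%:R * t))) ^+
    (Num.truncn (n.+1%:R * expR (n.+1%:R * a))).+1 @[n --> \oo] --> (1 : R).
Proof.
move=> ta a0; set d := t - a; have d0 : 0 < d by rewrite subr_gt0.
have t0 : 0 <= t by rewrite (le_trans a0)// ltW.
apply: (@cvg_of_le_harmonic _ _ _ (4 / d ^+ 2)) => n.
set N := (Num.truncn _).+1; set x := expR (- (n.+1%:R * t)).
have x0 : 0 < x by exact: expR_gt0.
have x1 : x <= 1 by rewrite expR_le1 oppr_le0 mulr_ge0.
have y1 : (1 - x) ^+ N <= 1 by rewrite exprn_ile1 ?subr_ge0// gerBl ltW.
rewrite ler0_norm ?subr_le0// opprB lerBlDr addrC -lerBlDr.
have x01 : 0 <= x <= 1 by rewrite (ltW x0).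
apply: le_trans (bernoulli_le N x01); rewrite lerB//.
have NE : N%:R <= n.+1%:R * expR (n.+1%:R * a) + n.+1%:R.
  rewrite /N -[_.+1%:R in leLHS]natr1 lerD ?ler1n// truncn_le// mulr_ge0 ?expR_ge0//.
have xE : expR (n.+1%:R * a) * x = expR (- (n.+1%:R * d)).
  by rewrite /x -expRD /d; congr expR; ring.
have xd : x <= expR (- (n.+1%:R * d)).
  by rewrite ler_expR lerN2 ler_wpM2l// gerBl.
apply: (@le_trans _ _ (2 * n.+1%:R * expR (- (n.+1%:R * d)))).
  apply: (le_trans (ler_wpM2r (ltW x0) NE)); rewrite mulrDl.
  rewrite -(mulrA _ _ x) xE.
  by rewrite -[2 * _ * _]mulrA [leRHS]mulr_natl mulr2n lerD// ler_wpM2l.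
have nd0 : 0 <= n.+1%:R * d by rewrite mulr_ge0 ?ltW.
have := @expR_ge1Dxn R _ 1 nd0 => h.
have {}h : (n.+1%:R * d) ^+ 2 / 2 <= expR (n.+1%:R * d).
  by apply: le_trans h; rewrite ler_wpDl.
rewrite expRN ler_pdivrMr ?expR_gt0//.
have dn0 : d != 0 by rewrite gt_eqF.
have n0 : n.+1%:R != 0 :> R by rewrite pnatr_eq0.
apply: (@le_trans _ _ (4 / d ^+ 2 / n.+1%:R * ((n.+1%:R * d) ^+ 2 / 2))).
  by rewrite le_eqVlt; apply/orP; left; apply/eqP; field; apply/andP.
by rewrite ler_wpM2l// !divr_ge0// exprn_ge0 ?ltW.
Qed.

Lemma measurable_expRl (R : realType) (l : R) :
  measurable_fun setT (fun t : R => expR (- (l * t))).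
Proof.
apply: measurableT_comp; first exact: measurable_expR.
by apply: measurable_funN; exact: measurable_funM.
Qed.

Section CosineTransform.
Context (R : realType) (nu1 nu2 : {measure set (measurableTypeR R) -> \bar R}).
Let D : set R := `[0%R, +oo[%classic.
Let mD : measurable (D : set (measurableTypeR R)).
Proof. exact: measurable_itv. Qed.

Let D_ge0 t : D t -> 0 <= t.
Proof. by rewrite /D/= in_itv/= andbT. Qed.

Hypothesis fin1 : (nu1 D < +oo)%E.
Hypothesis fin2 : (nu2 D < +oo)%E.

Definition agree (g : R -> R) : Prop :=
  \int[nu1]_(t in D) g t = \int[nu2]_(t in D) g t.

Let test (g : R -> R) : Prop :=
  measurable_fun setT g /\ exists C, forall t, 0 <= t -> `|g t| <= C.

Let test_int (nu : {measure set (measurableTypeR R) -> \bar R}) g :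
  (nu D < +oo)%E -> test g -> nu.-integrable D (EFin \o g).
Proof.
move=> nuD [mg [C gC]]; apply: measurable_bounded_integrable => //.
  exact: measurable_funTS.
exists C; split; first exact: num_real.
by move=> y Cy t /D_ge0 t0; apply: le_trans (ltW Cy); exact: gC.
Qed.

Lemma agree_limit (g_ : nat -> R -> R) (g : R -> R) :
  (forall n, measurable_fun setT (g_ n)) -> measurable_fun setT g ->
  (forall n t, 0 <= t -> `|g_ n t| <= 1) ->
  (forall t, 0 <= t -> g_ n t @[n --> \oo] --> g t) ->
  (forall n, agree (g_ n)) -> agree g.
Proof.
move=> mg_ mg g1 gcvg ag.
have cv (nu : {measure set (measurableTypeR R) -> \bar R}) : (nu D < +oo)%E ->
  (\int[nu]_(t in D) (g_ n t)%:E)%E @[n --> \oo] -->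
  (\int[nu]_(t in D) (g t)%:E)%E /\ nu.-integrable D (EFin \o g).
  move=> nuD.
  have := @dominated_convergence _ _ _ nu D mD (fun n => EFin \o g_ n) (EFin \o g)
    (EFin \o cst 1).
  case.
  - by move=> n; apply/measurable_EFinP; apply: measurable_funTS; exact: mg_.
  - by apply/measurable_EFinP; exact: measurable_funTS.
  - apply/nearW => t /D_ge0 t0.
    by apply: cvg_EFin; [exact: nearW|exact: gcvg].
  - by apply: test_int => //; split => //; exists 1 => t _; rewrite normr1.
  - by apply/nearW => t n /D_ge0 t0; rewrite /= lee_fin g1.
  by [].
have [cv1 i1] := cv nu1 fin1; have [cv2 i2] := cv nu2 fin2.
rewrite /agree /Rintegral; congr fine; apply: (cvg_unique _ cv1) => //.
suff -> : (fun n => \int[nu1]_(t in D) (g_ n t)%:E)%E =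
  (fun n => \int[nu2]_(t in D) (g_ n t)%:E)%E by [].
apply/funext => n; have := ag n; rewrite /agree /Rintegral => H.
rewrite -[LHS]fineK ?H ?fineK//.
  by apply: integrable_fin_num => //; apply: test_int => //; split => //; exists 1; exact: g1.
by apply: integrable_fin_num => //; apply: test_int => //; split => //; exists 1; exact: g1.
Qed.

Let testZ c g : test g -> test (fun t => c * g t).
Proof.
move=> [mg [C gC]]; split; first exact: measurable_funM.
by exists (`|c| * C) => t t0; rewrite normrM ler_wpM2l// gC.
Qed.

Let testD g h : test g -> test h -> test (fun t => g t + h t).
Proof.
move=> [mg [C gC]] [mh [C' hC]]; split; first exact: measurable_funD.
by exists (C + C') => t t0; rewrite (le_trans (ler_normD _ _))// lerD ?gC ?hC.
Qed.

Let agreeZ c g : test g -> agree g -> agree (fun t => c * g t).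
Proof. by move=> tg ag; rewrite /agree !RintegralZl ?ag//; exact: test_int. Qed.

Let agreeD g h : test g -> test h -> agree g -> agree h ->
  agree (fun t => g t + h t).
Proof.
by move=> tg th ag ah; rewrite /agree !RintegralD ?ag ?ah//; exact: test_int.
Qed.

Hypothesis cos_agree : forall s : R, agree (fun t => cos (s * Num.sqrt t)).

Let measurable_cos_sqrt (s : R) :
  measurable_fun setT (fun t : R => cos (s * Num.sqrt t)).
Proof.
have := measurable_cosn 0 s; rewrite /cosn.
by under [X in measurable_fun _ X -> _]eq_fun do rewrite mul0r addr0.
Qed.

Let cosX_test (s b : R) m :
  test (fun t => cos (s * Num.sqrt t) * cos (b * Num.sqrt t) ^+ m).
Proof.
split; first by apply: measurable_funM => //; exact: measurable_funX.
exists 1 => t _; rewrite normrM normrX mulr_ile1 ?exprn_ge0 ?exprn_ile1//;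
  exact: cos_max.
Qed.

(** Products of cosines are sums of cosines. *)
Lemma agree_cosX m (s b : R) :
  agree (fun t => cos (s * Num.sqrt t) * cos (b * Num.sqrt t) ^+ m).
Proof.
elim: m s => [|m IH] s.
  by rewrite (_ : (fun t => _) = fun t => cos (s * Num.sqrt t))//;
    apply/funext => t; rewrite expr0 mulr1.
have tp := cosX_test (s + b) b m; have tm := cosX_test (s - b) b m.
have := agreeZ 2^-1 (testD tp tm) (agreeD tp tm (IH (s + b)) (IH (s - b))).
congr agree; apply/funext => t.
by rewrite mulrDl mulrBl cosD cosB exprS; field.
Qed.

Lemma agree_expR (l : R) : 0 <= l -> agree (fun t => expR (- (l * t))).
Proof.
move=> l0.
(* With this [b n], (b n sqrt t)^2 / 2 = l t / (n + 1). *)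
pose b n : R := Num.sqrt (2 * l / n.+1%:R).
apply: (@agree_limit (fun n t => cos (b n * Num.sqrt t) ^+ n.+1)).
- by move=> n; exact: measurable_funX.
- exact: measurable_expRl.
- by move=> n t _; rewrite normrX exprn_ile1// cos_max.
- move=> t t0; apply: (@cvg_of_le_harmonic _ _ _ (4 * (l * t) ^+ 2)) => n.
  have u0 : 0 <= b n * Num.sqrt t by rewrite mulr_ge0 ?sqrtr_ge0.
  have u2 : (b n * Num.sqrt t) ^+ 2 = 2 * l * t / n.+1%:R.
    by rewrite exprMn !sqr_sqrtr// ?divr_ge0 ?mulr_ge0//; ring.
  have := cosX_expR n.+1 u0; rewrite (exprM _ 2 2) u2.
  have n0 : n.+1%:R != 0 :> R by rewrite pnatr_eq0.
  rewrite (_ : n.+1%:R * (2 * l * t / n.+1%:R / 2) = l * t); last by field.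
  move=> /le_trans; apply; rewrite le_eqVlt; apply/orP; left; apply/eqP.
  by field.
- move=> n; have := agree_cosX n.+1 0 (b n).
  by congr agree; apply/funext => t; rewrite mul0r cos0 mul1r.
Qed.

Let expR_test (l : R) : 0 <= l -> test (fun t => expR (- (l * t))).
Proof.
move=> l0; split; first exact: measurable_expRl.
exists 1 => t t0; rewrite ger0_norm ?expR_ge0// expR_le1 oppr_le0 mulr_ge0//.
Qed.

Lemma agree_expRX N (l b : R) : 0 <= l -> 0 <= b ->
  test (fun t => expR (- (l * t)) * (1 - expR (- (b * t))) ^+ N) /\
  agree (fun t => expR (- (l * t)) * (1 - expR (- (b * t))) ^+ N).
Proof.
move=> + b0; elim: N l => [|N IH] l l0.
  rewrite (_ : (fun t => _) = fun t => expR (- (l * t))); last first.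
    by apply/funext => t; rewrite expr0 mulr1.
  by split; [exact: expR_test|exact: agree_expR].
have [t1 a1] := IH l l0; have [t2 a2] := IH (l + b) (addr_ge0 l0 b0).
have t2' := testZ (-1) t2.
have E : (fun t => expR (- (l * t)) * (1 - expR (- (b * t))) ^+ N.+1) =
    (fun t => expR (- (l * t)) * (1 - expR (- (b * t))) ^+ N +
      -1 * (expR (- ((l + b) * t)) * (1 - expR (- (b * t))) ^+ N)).
  by apply/funext => t; rewrite exprS [(l + b) * t]mulrDl opprD expRD; ring.
by rewrite E; split; [exact: testD|apply: agreeD => //; exact: agreeZ].
Qed.

Lemma agree_ray (a : R) : 0 <= a -> agree (\1_(`]a, +oo[%classic) : R -> R).
Proof.
move=> a0.
pose N n := (Num.truncn (n.+1%:R * expR (n.+1%:R * a))).+1.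
apply: (@agree_limit (fun n t => (1 - expR (- (n.+1%:R * t))) ^+ N n)).
- move=> n; apply: measurable_funX; apply: measurable_funB => //.
  exact: measurable_expRl.
- exact: measurable_indic.
- move=> n t t0; have := expR_ge0 (- (n.+1%:R * t)).
  have : expR (- (n.+1%:R * t)) <= 1 by rewrite expR_le1 oppr_le0 mulr_ge0.
  by move=> e1 e0; rewrite ger0_norm ?exprn_ge0 ?exprn_ile1 ?subr_ge0// gerBl.
- move=> t t0; rewrite indicE; case: (ltP a t) => [ta|ta].
    rewrite mem_set/= ?in_itv/= ?ta//.
    exact: one_sub_expRX_cvg1.
  rewrite memNset/= ?in_itv/= ?andbT; last by apply/negP; rewrite -leNgt.
  exact: one_sub_expRX_cvg0.
- move=> n; have [_] := @agree_expRX (N n) 0 n.+1%:R (lexx _) (ler0n _ _).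
  by congr agree; apply/funext => t; rewrite mul0r oppr0 expR0 mul1r.
Qed.

Hypothesis nu1_neg : on_Rplus nu1.
Hypothesis nu2_neg : on_Rplus nu2.

(** Rays generate the Borel sets, and the total mass is the value at
    [s = 0]. *)
Theorem cosine_transform_unique (A : set (measurableTypeR R)) :
  measurable A -> nu1 A = nu2 A.
Proof.
have RE (nu : {measure set (measurableTypeR R) -> \bar R}) (B : set R) :
    on_Rplus nu -> measurable (B : set (measurableTypeR R)) ->
    nu B = nu (B `&` D).
  move=> nuN mB; rewrite -[in LHS](setIT B) -(setUv D) setIUr.
  rewrite measureU//; [|exact: measurableI|by apply: measurableI => //; exact: measurableC|].
    rewrite [X in (_ + X)%E](_ : _ = 0%E) ?adde0//.
    apply: (subset_measure0 _ _ _ nuN) => //.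
      by apply: measurableI => //; exact: measurableC.
    by move=> t [_]; rewrite /D /= !in_itv/= andbT => /negP; rewrite -ltNge.
  by rewrite setIACA setICr setI0.
have fin (nu : {measure set (measurableTypeR R) -> \bar R}) (B : set R) :
    (nu D < +oo)%E -> measurable (B : set (measurableTypeR R)) ->
    nu (B `&` D) \is a fin_num.
  move=> nuD mB; rewrite ge0_fin_numE//; apply: le_lt_trans nuD.
  by apply: le_measure; rewrite ?inE//; exact: measurableI.
have ray (a : R) : nu1 (`]a, +oo[%classic) = nu2 (`]a, +oo[%classic).
  rewrite (RE nu1)// (RE nu2)//.
  have [a0|a0] := leP 0 a.
    have := agree_ray a0; rewrite /agree /Rintegral !integral_indic//.
    move=> H; rewrite -[LHS]fineK ?H ?fineK//; exact: fin.
  have -> : `]a, +oo[%classic `&` D = D.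
    by apply: setIidr => t /D_ge0 t0; rewrite /= in_itv/= andbT (lt_le_trans a0).
  have := cos_agree 0; rewrite /agree /Rintegral.
  rewrite (_ : (fun t : R => (cos (0 * Num.sqrt t))%:E) = cst 1%E).
    by rewrite !integral_cst// !mul1e => H; rewrite -[LHS]fineK ?H ?fineK// -(setIT D) setIC; exact: fin.
  by apply/funext => t; rewrite mul0r cos0.
pose g k : set (measurableTypeR R) := `](- k%:R), +oo[%classic.
have Gg k : RGenOInfty.G (g k) by exists (- k%:R).
have GI : setI_closed (@RGenOInfty.G R).
  move=> _ _ [x ->] [y ->]; exists (Num.max x y).
  by apply/seteqP; split => t /=; rewrite !in_itv/= !andbT gt_max => /andP.
have gT : \bigcup_k g k = setT.
  rewrite -subTset => t _; exists (Num.truncn `|t|).+1 => //=.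
  rewrite /g/= in_itv/= andbT ltrNl (le_lt_trans _ (truncnS_gt _))//.
  by rewrite -normrN ler_norm.
move=> mA; apply: (@measure_unique _ R (measurableTypeR R) _ g
  (RGenOInfty.measurableE R) GI Gg gT nu1 nu2 _ _ A mA).
- by move=> _ [x ->]; exact: ray.
- move=> k; have mgk : measurable (g k) by exact: measurable_itv.
  by rewrite (RE _ _ nu1_neg mgk) -ge0_fin_numE//; exact: fin.
Qed.

End CosineTransform.

Lemma sin_natpi (R : realType) n : sin (n%:R * pi) = 0 :> R.
Proof.
elim: n => [|n IH]; first by rewrite mul0r sin0.
by rewrite -[n.+1%:R]natr1 mulrDl mul1r sinDpi IH oppr0.
Qed.

(** The odd derivatives at 0 vanish because those of the cosine do, the even
    ones because the moments agree. *)
Theorem carleman_determinacy (R : realType)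
    (nu1 nu2 : {measure set (measurableTypeR R) -> \bar R}) (g : nat -> R) :
  on_Rplus nu1 -> on_Rplus nu2 ->
  (forall n, (\int[nu1]_(t in `[0%R, +oo[%classic) (t ^+ n)%:E = (g n)%:E)%E) ->
  (forall n, (\int[nu2]_(t in `[0%R, +oo[%classic) (t ^+ n)%:E = (g n)%:E)%E) ->
  (forall n, 0 < g n) ->
  carleman_divergent g ->
  forall A : set (measurableTypeR R), measurable A -> nu1 A = nu2 A.
Proof.
move=> N1 N2 g1 g2 g0 gdiv.
have m1 n : (\int[nu1]_(t in `[0%R, +oo[%classic) (t ^+ n)%:E < +oo)%E.
  by rewrite g1 ltry.
have m2 n : (\int[nu2]_(t in `[0%R, +oo[%classic) (t ^+ n)%:E < +oo)%E.
  by rewrite g2 ltry.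
have h1 n : half_moment nu1 n.*2 = g n.
  by rewrite half_moment_double// /Rintegral g1.
have h2 n : half_moment nu2 n.*2 = g n.
  by rewrite half_moment_double// /Rintegral g2.
pose M n := half_moment nu1 n + half_moment nu2 n.
have M_ge0 n : 0 <= M n by rewrite addr_ge0// half_moment_ge0.
have Mq n (l : R) : 2 * l * M n.+1 <= l ^+ 2 * M n + M n.+2.
  by rewrite !mulrDr addrACA lerD// half_moment_quadratic.
have M_double n : M n.*2 = 2 * g n by rewrite /M h1 h2 mulr_natl mulr2n.
have M_gt0 n : 0 < M n.
  have [on|/negbTE en] := boolP (odd n); last first.
    by rewrite -(odd_double_half n) en add0n M_double mulr_gt0.
  rewrite lt_neqAle M_ge0 andbT eq_sym; apply/eqP => Mn0.
  have M1 : 0 < M n.+1.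
    by rewrite -[n.+1]odd_double_half/= on add0n M_double mulr_gt0.
  (* Any number above M_{n+2} / (2 M_{n+1}) contradicts M_n = 0. *)
  have := Mq n ((M n.+2 + 1) / M n.+1).
  rewrite Mn0 mulr0 add0r -mulrA divfK ?gt_eqF//.
  have := M_ge0 n.+2; lra.
have M_convex n : M n.+1 ^+ 2 <= M n * M n.+2.
  have := Mq n (M n.+1 / M n); have := M_gt0 n => Mn.
  rewrite (_ : 2 * _ * _ = 2 * (M n.+1 ^+ 2 / M n)); last by rewrite expr2; ring.
  rewrite (_ : _ ^+ 2 * _ = M n.+1 ^+ 2 / M n); last first.
    by field; rewrite gt_eqF.
  move=> H; have {}H : M n.+1 ^+ 2 / M n <= M n.+2 by lra.
  by rewrite mulrC -ler_pdivrMr.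
have Mdiv : carleman_divergent (fun n => M n.*2).
  move=> A; have [N HN] := gdiv (2 * A); exists N.
  rewrite -ler_pdivlMl ?mulr_gt0// in HN.
  apply: (le_trans HN); rewrite mulr_sumr big_nat_cond [leRHS]big_nat_cond.
  apply: ler_sum => n /andP[/andP[n1 _] _].
  rewrite M_double powRM// ?(ltW (g0 n))//.
  rewrite ler_wpM2r ?powR_ge0// powRN lef_pV2 ?posrE ?powR_gt0//.
  by apply: ler1_powR; rewrite ?ler1n// invf_le1 ?ltr0n ?double_gt0// ler1n double_gt0.
have Mratio := ratio_divergence M_gt0 Mdiv.
pose f n s := cos_moment nu1 n s - cos_moment nu2 n s.
have f_le n s : `|f n s| <= M n.
  by rewrite (le_trans (ler_normB _ _))// lerD// cos_moment_le.
have f_taylor m n (s h : R) : 0 <= h ->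
  `|f n (s + h) - \sum_(j < m) f (n + j)%N s * (h ^+ j / j`!%:R)|
    <= M (n + m)%N * (h ^+ m / m`!%:R).
  move=> h0; rewrite /f /M mulrDl.
  under eq_bigr do rewrite mulrBl.
  rewrite sumrB.
  rewrite [X in `|X|](_ : _ = (cos_moment nu1 n (s + h) -
     \sum_(j < m) cos_moment nu1 (n + j) s * (h ^+ j / j`!%:R)) -
     (cos_moment nu2 n (s + h) -
     \sum_(j < m) cos_moment nu2 (n + j) s * (h ^+ j / j`!%:R))); last by ring.
  by rewrite (le_trans (ler_normB _ _))// lerD// cos_moment_taylor.
have f_flat n : f n 0 = 0.
  have cm (nu : {measure set (measurableTypeR R) -> \bar R}) : (forall n,
      (\int[nu]_(t in `[0%R, +oo[%classic) (t ^+ n)%:E < +oo)%E) ->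
      cos_moment nu n 0 = cosn n 0 * half_moment nu n.
    move=> mom; rewrite /cos_moment.
    under eq_Rintegral do rewrite mul0r.
    rewrite [RHS]mulrC; apply: RintegralZr; last exact: integrable_sqrtX.
    exact: measurable_itv.
  rewrite /f !cm// -mulrBr.
  have [on|en] := boolP (odd n); last first.
    by rewrite -(odd_double_half n) (negbTE en) add0n h1 h2 subrr mulr0.
  rewrite -(odd_double_half n) on /cosn add0r natrD mulrDl mul1r addrC cosDpihalf.
  rewrite (_ : _ * (pi / 2) = (n./2)%:R * pi); last first.
    by rewrite -mul2n natrM; field.
  by rewrite sin_natpi oppr0 mul0r.
have key := @bang_vanishing R M f M_gt0 M_convex f_le f_taylor f_flat Mratio.
apply: cosine_transform_unique => //; try exact: finite_half_line.
move=> s; rewrite /agree; apply/eqP; rewrite -subr_eq0; apply/eqP.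
rewrite -[RHS](key `|s| (normr_ge0 _)) /f /cos_moment.
have E t : Num.sqrt t ^+ 0 * cosn 0 (`|s| * Num.sqrt t) = cos (s * Num.sqrt t).
  rewrite expr0 mul1r /cosn mul0r addr0 -[in RHS]cos_norm normrM.
  by rewrite (ger0_norm (sqrtr_ge0 t)).
by congr (_ - _); apply: eq_Rintegral => t _; rewrite E.
Qed.

(** * Stability of the Carleman condition *)

(** The exponent of [C] is at most 1, so each term changes by a factor of at
    most [C]. *)
Lemma carleman_divergent_le (R : realType) (g g' : nat -> R) (C : R) :
  1 <= C -> (forall n, 0 < g n) -> (forall n, 0 < g' n) ->
  (forall n, g' n <= C * g n) ->
  carleman_divergent g -> carleman_divergent g'.
Proof.
move=> C1 g0 g'0 gg' gdiv A; have C0 : 0 < C by exact: lt_le_trans C1.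
have [N HN] := gdiv (C * A); exists N.
rewrite -ler_pdivlMl// in HN; apply: (le_trans HN).
rewrite mulr_sumr big_nat_cond [leRHS]big_nat_cond.
apply: ler_sum => n /andP[/andP[n1 _] _].
have p0 : 0 <= n.*2%:R^-1 :> R by rewrite invr_ge0.
apply: (@le_trans _ _ ((C * g n) `^ (- n.*2%:R^-1))); last first.
  rewrite !powRN lef_pV2 ?posrE ?powR_gt0 ?mulr_gt0//.
  by rewrite ge0_ler_powR ?nnegrE ?mulr_ge0 ?(ltW C0) ?(ltW (g0 n)) ?(ltW (g'0 n)).
rewrite powRM ?(ltW C0) ?(ltW (g0 n))//.
rewrite ler_wpM2r ?powR_ge0// powRN lef_pV2 ?posrE ?powR_gt0//.
apply: ler1_powR => //.
by rewrite invf_le1 ?ltr0n ?double_gt0// ler1n double_gt0.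
Qed.

(** The terms of the Carleman series of a shifted sequence are powers
    b^(1 + 1/n) of the terms b of the original one. A term below the summable
    (n + 1)^-2 is negligible, and for the others b^(1/n) is at least 1/4, as
    n + 1 <= 2^n. *)
Lemma powR_shift_le (R : realType) (b : R) n : 0 < b -> (0 < n)%N ->
  b <= (n.+1%:R ^+ 2)^-1 + 4 * (b `^ (1 + n%:R^-1)).
Proof.
move=> b0 n0; have bp : 0 <= b `^ (1 + n%:R^-1) by exact: powR_ge0.
have n10 : 0 < n.+1%:R :> R by [].
have [bs|bl] := leP b (n.+1%:R ^+ 2)^-1.
  by rewrite ler_wpDr// mulr_ge0.
rewrite ler_wpDl ?invr_ge0 ?exprn_ge0//.
rewrite powRD; last by rewrite (gt_eqF b0) implybT.
rewrite powRr1 ?(ltW b0)// mulrCA ler_pMr// -ler_pdivrMl// mulr1.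
have np : 0 <= n%:R^-1 :> R by rewrite invr_ge0.
apply: (@le_trans _ _ ((4^-1 ^+ n) `^ n%:R^-1)).
  rewrite -powR_mulrn ?invr_ge0// -powRrM divff ?powRr1 ?invr_ge0//.
  by rewrite pnatr_eq0 -lt0n.
rewrite ge0_ler_powR ?nnegrE ?exprn_ge0 ?invr_ge0 ?(ltW b0)//.
apply: le_trans (ltW bl); rewrite exprVn lef_pV2 ?posrE ?exprn_gt0//.
rewrite (_ : 4 = 2 ^+ 2 :> R); last by rewrite expr2; lra.
rewrite -exprM mulnC exprM lerXn2r ?nnegrE ?exprn_ge0//.
by rewrite -natrX ler_nat ltn_expl.
Qed.

Lemma sum_inv_sqr_le (R : realType) N :
  \sum_(1 <= n < N.+1) (n.+1%:R ^+ 2)^-1 <= 1 - N.+1%:R^-1 :> R.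
Proof.
elim: N => [|N IH]; first by rewrite big_geq// invr1 subrr.
rewrite big_nat_recr//=; apply: (le_trans (lerD IH (lexx _))).
rewrite -[N.+2%:R]natr1; set a : R := N.+1%:R.
have a0 : 0 < a by rewrite /a.
have a10 : 0 < a + 1 by rewrite addr_gt0.
rewrite -subr_ge0.
have -> : 1 - (a + 1)^-1 - (1 - a^-1 + ((a + 1) ^+ 2)^-1) =
   (a * (a + 1) ^+ 2)^-1.
  by field; rewrite !gt_eqF.
by rewrite invr_ge0 mulr_ge0 ?exprn_ge0 ?ltW.
Qed.

Lemma carleman_divergent_shift (R : realType) (g : nat -> R) :
  (forall n, 0 < g n) -> carleman_divergent g ->
  carleman_divergent (fun n => g n.+1).
Proof.
move=> g0 gdiv A.
pose b n := g n `^ (- n.*2%:R^-1).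
have b0 n : 0 < b n by rewrite powR_gt0.
have bS n : (0 < n)%N -> b n.+1 `^ (1 + n%:R^-1) = g n.+1 `^ (- n.*2%:R^-1).
  move=> n0; rewrite /b -powRrM; congr (_ `^ _).
  rewrite -!mul2n !natrM -[n.+1%:R]natr1.
  have : n%:R != 0 :> R by rewrite pnatr_eq0 -lt0n.
  have : n%:R + 1 != 0 :> R by rewrite natr1 pnatr_eq0.
  by move=> ? ?; field; apply/andP.
have [N HN] := gdiv (b 1%N + 1 + 4 * A).
exists N.
have [N1|N1] := leqP N 1.
  move: HN; rewrite !big_geq// => H.
  have := b0 1%N; lra.
have E : \sum_(1 <= n < N) g n `^ (- n.*2%:R^-1) <=
    b 1%N + \sum_(1 <= n < N) b n.+1.
  have E K : \sum_(1 <= n < K.+2) b n = b 1%N + \sum_(1 <= n < K.+1) b n.+1.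
    elim: K => [|K IH]; first by rewrite big_nat1 big_geq// addr0.
    by rewrite big_nat_recr// IH [in RHS]big_nat_recr// addrA.
  case: N N1 {HN} => [|[|K]]// _; rewrite -/b E lerD2l.
  by rewrite [leRHS]big_nat_recr//= lerDl ltW.
have F : \sum_(1 <= n < N) b n.+1 <=
    1 + 4 * \sum_(1 <= n < N) g n.+1 `^ (- n.*2%:R^-1).
  apply: (@le_trans _ _ (\sum_(1 <= n < N) (n.+1%:R ^+ 2)^-1 +
      4 * \sum_(1 <= n < N) g n.+1 `^ (- n.*2%:R^-1))).
    rewrite mulr_sumr -big_split/= big_nat_cond [leRHS]big_nat_cond.
    apply: ler_sum => n /andP[/andP[n1 _] _].
    by rewrite -bS//; exact: powR_shift_le.
  rewrite lerD2r; case: N N1 {HN E} => // N _.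
  by apply: (le_trans (sum_inv_sqr_le R N)); rewrite gerBl.
lra.
Qed.

Lemma CarlemanE (R : realType) (g : nat -> R) : (forall n, 0 < g n) ->
  Carleman (fun n => (g n)%:E) <-> carleman_divergent g.
Proof.
move=> g0.
have E : (\sum_(1 <= n <oo) (((g n)%:E `^ ((2 * n)%:R^-1)%R)^-1) =
    \sum_(1 <= n <oo) (g n `^ (- n.*2%:R^-1))%:E)%E.
  apply: eq_eseriesr => n _.
  rewrite poweR_EFin inver gt_eqF ?powR_gt0//.
  by rewrite powRN mul2n.
have t0 n : (0 <= (g n `^ (- n.*2%:R^-1))%:E :> \bar R)%E.
  by rewrite lee_fin powR_ge0.
split; rewrite /Carleman E.
  move=> [_ sumE] A; apply: contrapT => /forallNP H.
  suff : (+oo <= A%:E :> \bar R)%E by rewrite leye_eq.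
  rewrite -sumE; apply: lime_le; first exact: is_cvg_nneseries.
  apply: nearW => N; rewrite sumEFin lee_fin leNgt; apply/negP => AN.
  by apply: (H N); exact: ltW.
move=> gdiv; split; first by move=> n; rewrite lee_fin (ltW (g0 n)).
apply/eqyP => A _.
have [N HN] := gdiv A.
apply: le_trans (nneseries_lim_ge N _) => //.
by rewrite sumEFin lee_fin.
Qed.

(** * Constructions of measures *)

Local Open Scope ereal_scope.

Lemma esum_countE (R : realType) (I : countType) (F : I -> \bar R) :
  (forall i, 0 <= F i) ->
  \esum_(i in [set: I]) F i = \sum_(n <oo) oapp F 0 (pickle_inv n).
Proof.
move=> F0; rewrite nneseries_esumT; last by move=> n; case: pickle_inv => //= i.
transitivity (\esum_(n in range (@pickle I)) oapp F 0 (pickle_inv n)).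
  rewrite esum_image; last by move=> x y _ _; exact: (pcan_inj pickleK).
  by apply: eq_esum => i _; rewrite pickleK_inv.
rewrite esum_mkcond; apply: eq_esum => n _; case: ifPn => //.
case E : (pickle_inv n) => [i|//] /negP[]; rewrite inE; exists i => //.
by have := @pickle_invK I n; rewrite E.
Qed.

Lemma measure_countable_union d (T : measurableType d) (R : realType)
    (mu : {measure set T -> \bar R}) (I : countType) (B : I -> set T) :
  (forall i, measurable (B i)) -> trivIset setT B ->
  mu (\bigcup_i B i) = \esum_(i in [set: I]) mu (B i).
Proof.
move=> mB tB; rewrite esum_countE//.
have -> : \bigcup_i B i = \bigcup_n oapp B set0 (@pickle_inv I n).
  apply/seteqP; split => t.
    by move=> [i _ Bit]; exists (pickle i) => //; rewrite pickleK_inv.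
  by move=> [n _]; case: pickle_inv => //= i Bit; exists i.
have mB' n : measurable (oapp B set0 (@pickle_inv I n)).
  by case: pickle_inv => //=.
rewrite measure_semi_bigcup//.
- by apply: eq_eseriesr => n _; case: pickle_inv => //=.
- move=> n m _ _ [t []].
  case En : (pickle_inv n) => [i|//]; case Em : (pickle_inv m) => [j|//] /= Bi Bj.
  have ij : i = j by apply: tB => //; exists t.
  have := @pickle_invK I n; have := @pickle_invK I m.
  by rewrite En Em /= ij => -> ->.
- exact: bigcupT_measurable.
Qed.

Lemma measure_sum_exists d (T : measurableType d) (R : realType) (I : countType)
    (nu : I -> {measure set T -> \bar R}) :
  exists W : {measure set T -> \bar R},
    (forall A, W A = \esum_(i in [set: I]) nu i A) /\
    forall s f, measurable s -> measurable_fun s f -> (forall t, s t -> 0 <= f t) ->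
      \int[W]_(t in s) f t = \esum_(i in [set: I]) \int[nu i]_(t in s) f t.
Proof.
pose m_ n : {measure set T -> \bar R} := oapp nu mzero (@pickle_inv I n).
exists (mseries m_ 0); split => [A|s f ms mf f0].
  rewrite esum_countE//; apply: eq_eseriesr => n _.
  by rewrite /m_; case: pickle_inv.
rewrite ge0_integral_measure_series// esum_countE; last first.
  by move=> i; exact: integral_ge0.
apply: eq_eseriesr => n _; rewrite /m_; case: pickle_inv => //=.
by rewrite integral_measure_zero.
Qed.

Definition has_density d (T : measurableType d) (R : realType)
    (m nu : {measure set T -> \bar R}) (g : T -> R) : Prop :=
  forall s f, measurable s -> measurable_fun s f ->
    (forall t, s t -> 0 <= f t) ->
    \int[nu]_(t in s) f t = \int[m]_(t in s) ((g t)%:E * f t).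

(** Measures are produced by existence statements together with an integration
    formula on every measurable domain, which is all that is used of them. *)
Section Density.
Context d (T : measurableType d) (R : realType).
Context (m : {measure set T -> \bar R}) (g : T -> R).
Hypothesis mg : measurable_fun setT g.
Hypothesis g0 : forall x, (0 <= g x)%R.

Let dens (A : set T) := \int[m]_(x in A) (g x)%:E.

Let mgE A : measurable_fun A (EFin \o g).
Proof. by apply/measurable_EFinP; exact: measurable_funTS. Qed.

Let dens0 : dens set0 = 0.
Proof. by rewrite /dens integral_set0. Qed.

Let dens_ge0 A : 0 <= dens A.
Proof. by apply: integral_ge0 => x _; rewrite lee_fin. Qed.

Let dens_sigma : semi_sigma_additive dens.
Proof.
move=> F mF tF mUF; rewrite /dens; apply: cvg_toP.
  apply: ereal_nondecreasing_is_cvgn => i j ij.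
  by apply: lee_sum_nneg_natr => // k _ _; exact: dens_ge0.
rewrite [RHS]ge0_integral_bigcup//=.
by move=> x _; rewrite lee_fin.
Qed.

HB.instance Definition _ := isMeasure.Build _ _ _ dens dens0 dens_ge0 dens_sigma.

Import HBNNSimple.

Let integral_dens_indic E : measurable E ->
  \int[dens]_x (\1_E x)%:E = \int[m]_x ((g x)%:E * (\1_E x)%:E).
Proof.
move=> mE; rewrite integral_indic// setIT /= /dens integral_mkcond.
apply: eq_integral => x _; rewrite patchE indicE.
by case: ifPn => _; rewrite ?mule1 ?mule0.
Qed.

Let integral_dens_nnsfun (f : {nnsfun T >-> R}) :
  \int[dens]_x (f x)%:E = \int[m]_x ((g x)%:E * (f x)%:E).
Proof.
under [LHS]eq_integral do rewrite fimfunE -fsumEFin//.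
rewrite [LHS]ge0_integral_fsum//; last 2 first.
  - by move=> r; exact/measurable_EFinP/measurableT_comp.
  - by move=> n x _; rewrite EFinM nnfun_muleindic_ge0.
under [RHS]eq_integral.
  move=> x xD; rewrite fimfunE -fsumEFin// ge0_mule_fsumr; last first.
    by move=> r; rewrite EFinM nnfun_muleindic_ge0.
  over.
rewrite [RHS]ge0_integral_fsum//; last 2 first.
  - move=> r; apply: emeasurable_funM; first exact: mgE.
    by apply/measurable_EFinP; do 2 apply/measurableT_comp => //.
  - move=> n x _; rewrite EFinM mule_ge0//; last by rewrite nnfun_muleindic_ge0.
    by rewrite lee_fin.
apply: eq_fsbigr => r _.
rewrite integralZl_indic_nnsfun//= integral_dens_indic//.
have [r0|r0] := leP 0%R r; last first.
  rewrite preimage_nnfun0// !integral0_eq ?mule0// => x _;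
    rewrite ?indic0 ?mulr0 ?mule0//.
rewrite -ge0_integralZl//.
- by apply: eq_integral => x _; rewrite EFinM muleCA.
- apply: emeasurable_funM; first exact: mgE.
  by apply/measurable_EFinP; exact: measurable_indic.
- by move=> x _; rewrite mule_ge0// lee_fin.
Qed.

Let integral_dens (f : T -> \bar R) :
  measurable_fun setT f -> (forall x, 0 <= f x) ->
  \int[dens]_x f x = \int[m]_x ((g x)%:E * f x).
Proof.
move=> mf f0.
pose f_ := nnsfun_approx measurableT mf.
transitivity (lim (\int[dens]_x (f_ n x)%:E @[n --> \oo])%E).
  rewrite -monotone_convergence//=.
  - apply: eq_integral => ? /[!inE] xD; apply/esym/cvg_lim => //=.
    exact: cvg_nnsfun_approx.
  - by move=> n; exact/measurable_EFinP/measurable_funTS.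
  - by move=> n ? _; rewrite lee_fin.
  - by move=> ? _ ? ? mn; rewrite lee_fin; exact/lefP/nd_nnsfun_approx.
rewrite [RHS](_ : _ = lim (\int[m]_x ((g x)%:E * (f_ n x)%:E) @[n --> \oo])).
  by apply: congr_lim; apply/funext => n /=; exact: integral_dens_nnsfun.
rewrite -monotone_convergence//=.
- apply: eq_integral => x /[!inE] xD; apply/esym/cvg_lim => //.
  by apply: cvgeZl => //; exact: cvg_nnsfun_approx.
- move=> n; apply: emeasurable_funM; first exact: mgE.
  exact/measurable_EFinP/measurable_funTS.
- by move=> n x _; rewrite mule_ge0// lee_fin.
- move=> x _ i j ij; rewrite lee_wpmul2l// lee_fin//.
  exact/lefP/nd_nnsfun_approx.
Qed.

Lemma density_exists : exists nu : {measure set T -> \bar R},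
  (forall A, nu A = \int[m]_(x in A) (g x)%:E) /\ has_density m nu g.
Proof.
exists dens; split => // s f ms mf f0.
rewrite integral_mkcond integral_dens.
- rewrite [RHS]integral_mkcond; apply: eq_integral => x _; rewrite !patchE.
  by case: ifPn => // _; rewrite mule0.
- exact/(measurable_restrictT _ ms).
- by move=> x; rewrite patchE; case: ifPn => // /set_mem/f0.
Qed.

End Density.

Lemma add_atom_exists d (T : measurableType d) (R : realType)
    (m : {measure set T -> \bar R}) (p : T) (c : R) : (0 <= c)%R ->
  exists nu : {measure set T -> \bar R},
    (forall A, nu A = m A + c%:E * (\1_A p)%:E) /\
    forall s f, measurable s -> measurable_fun s f -> (forall t, s t -> 0 <= f t) ->
      \int[nu]_(t in s) f t = \int[m]_(t in s) f t + c%:E * ((\1_s p)%:E * f p).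
Proof.
move=> c0; exists (measure_add m (mscale (NngNum c0) (dirac p))); split.
  by move=> A; rewrite [LHS]measure_addE/= /mscale/= diracE.
move=> s f ms mf f0; rewrite ge0_integral_measure_add//; congr (_ + _).
by rewrite ge0_integral_mscale//= integral_dirac// diracE indicE.
Qed.

Lemma probability_exists d (T : measurableType d) (R : realType)
    (m : {measure set T -> \bar R}) : m setT = 1 ->
  exists P : probability T R, forall A, P A = m A.
Proof.
move=> m1; exists (mnormalize m (dirac point : probability T R)) => A.
rewrite /= /mnormalize.
by rewrite m1 onee_eq0/= invr1 mule1.
Qed.

Lemma integral_setI_conull d (T : measurableType d) (R : realType)
    (m : {measure set T -> \bar R}) (E s : set T) (f : T -> \bar R) :
  measurable E -> measurable s -> m (~` E) = 0 ->
  measurable_fun s f -> (forall t, s t -> 0 <= f t) ->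
  \int[m]_(t in s) f t = \int[m]_(t in s `&` E) f t.
Proof.
move=> mE ms mE0 mf f0.
rewrite (@ge0_negligible_integral _ _ _ _ s (~` E))//; last exact: measurableC.
by rewrite setDE setCK.
Qed.

Lemma integral_conull d (T : measurableType d) (R : realType)
    (m : {measure set T -> \bar R}) (E D : set T) (f : T -> \bar R) :
  measurable E -> measurable D -> E `<=` D -> m (~` E) = 0 ->
  measurable_fun D f -> (forall t, D t -> 0 <= f t) ->
  \int[m]_(t in D) f t = \int[m]_(t in E) f t.
Proof.
move=> mE mD ED mE0 mf f0.
by rewrite (integral_setI_conull mE mD mE0 mf f0) (setIidr ED).
Qed.

(** * Fibres of the iterates of phi *)

Section Preimages.
Context (eta : option nat) (kappa : nat).
Local Notation X := (Xset eta kappa).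
Local Notation phi := (@phi eta kappa).

Lemma phi_preimage_branch (i : J eta) j :
  phi @^-1` [set branch kappa i j] = [set branch kappa i j.+1].
Proof.
apply/seteqP; split => [[r|[i' [|j']]]|y ->] //=.
by rewrite /branch => -[-> ->].
Qed.

Lemma phi_preimage_circ (r : 'I_kappa.+1) : (r < kappa)%N ->
  phi @^-1` [set circ eta r] = [set circ eta (inord r.+1)].
Proof.
move=> rk; apply/seteqP; split => [[s|[i' [|j']]]|y ->] //=.
- rewrite /circ => -[]; case: eqP => [s0 /(congr1 val)/= rE|/eqP s0].
    by rewrite -rE ltnn in rk.
  have s1 : (0 < s)%N by rewrite lt0n.
  move=> /(congr1 val)/=; rewrite inordK ?(leq_ltn_trans (leq_pred _))// => <-.
  by rewrite prednK// inord_val.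
- by rewrite /circ => -[/(congr1 val)/= rE]; rewrite -rE ltnn in rk.
- rewrite /circ; congr inl; case: eqP => [/(congr1 val)|_].
    by rewrite /= inordK.
  by apply: val_inj; rewrite /= !inordK//= ?ltnS// ltnW.
Qed.

Lemma phi_preimage_circ_max :
  phi @^-1` [set circ eta ord_max] =
  [set circ eta ord0] `|` \bigcup_(i in [set: J eta]) [set branch kappa i 0].
Proof.
apply/seteqP; split => [[s|[i' [|j']]]|y [->|[i _ ->]]] //=.
- rewrite /circ => -[]; case: eqP => [-> _|/eqP s0]; first by left.
  have s1 : (0 < s)%N by rewrite lt0n.
  move=> /(congr1 val)/=; rewrite inordK ?(leq_ltn_trans (leq_pred _))// => sE.
  by have := ltn_ord s; rewrite -(prednK s1) sE ltnn.
- by move=> _; right; exists i'.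
Qed.

Section Masses.
Context (R : realType) (mu : {measure set X -> \bar R}).

Definition preimage_mass n x : \bar R := mu (iter n phi @^-1` [set x]).

Let iter_preimage n (B : set X) :
  iter n.+1 phi @^-1` B = iter n phi @^-1` (phi @^-1` B).
Proof. by []. Qed.

Lemma preimage_mass0 x : preimage_mass 0 x = mu [set x].
Proof. by []. Qed.

Lemma preimage_mass_branch n i j :
  preimage_mass n (branch kappa i j) = mu [set branch kappa i (j + n)].
Proof.
elim: n j => [|n IH] j; first by rewrite addn0.
by rewrite /preimage_mass iter_preimage phi_preimage_branch -addSnnS -IH.
Qed.

Lemma preimage_mass_circ n (r : 'I_kappa.+1) : (r < kappa)%N ->
  preimage_mass n.+1 (circ eta r) = preimage_mass n (circ eta (inord r.+1)).
Proof. by move=> rk; rewrite /preimage_mass iter_preimage phi_preimage_circ. Qed.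

Lemma preimage_mass_circ_max n :
  preimage_mass n.+1 (circ eta ord_max) = preimage_mass n (circ eta ord0) +
    \esum_(i in [set: J eta]) preimage_mass n (branch kappa i 0).
Proof.
rewrite /preimage_mass iter_preimage phi_preimage_circ_max preimage_setU.
rewrite preimage_bigcup.
have := @measure_countable_union _ X R mu (J eta)
  (fun i => iter n phi @^-1` [set branch kappa i 0]) (fun=> I).
move=> <-; last first.
  by move=> i i' _ _ [x [/= E1]]; rewrite E1 => -[].
apply: measureU => //.
by rewrite -subset0 => x [/= E1 [i _ /=]]; rewrite E1.
Qed.

Hypothesis hmu : discrete_measure mu.

Lemma atom_gt0 x : 0 < mu [set x]. Proof. exact: hmu.2. Qed.

Lemma atom_fin_num x : mu [set x] \is a fin_num.
Proof.
have [F FT Foo] := hmu.1; have : (\bigcup_i F i) x by rewrite -FT.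
move=> [n _ Fnx]; rewrite ge0_fin_numE//; apply: le_lt_trans (Foo n).2.
by apply: le_measure; rewrite ?inE// => _ ->.
Qed.

Definition atom x : R := fine (mu [set x]).

Lemma atomE x : mu [set x] = (atom x)%:E.
Proof. by rewrite /atom fineK// atom_fin_num. Qed.

Lemma atomR_gt0 x : (0 < atom x)%R.
Proof. by rewrite -lte_fin -atomE atom_gt0. Qed.

Lemma hphiE n x : hphi mu n x = preimage_mass n x * ((atom x)^-1)%:E.
Proof. by rewrite /hphi atomE inver gt_eqF// atomR_gt0. Qed.

Lemma preimage_massE n x : preimage_mass n x = (atom x)%:E * hphi mu n x.
Proof.
by rewrite hphiE muleCA -EFinM mulfV ?mule1// gt_eqF// atomR_gt0.
Qed.

(** Every fibre of an iterate over the cycle contains a point of the cycle, and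
    the cycle is finite. *)
Lemma circ_mass_lower_bound :
  exists2 d : R, (0 < d)%R & forall n r, d%:E <= preimage_mass n (circ eta r).
Proof.
pose d : R := \big[Num.min/1%R]_(r < kappa.+1) atom (circ eta r).
have d0 : (0 < d)%R.
  by rewrite /d; elim/big_ind: _ => [//|x y x0 y0|r _]; rewrite ?lt_min ?x0// atomR_gt0.
exists d => // n; elim: n => [|n IH] r.
  rewrite preimage_mass0 atomE lee_fin; exact: bigmin_le_cond.
have [rk|] := ltnP r kappa; first by rewrite preimage_mass_circ.
move=> kr; have -> : r = ord_max.
  by apply/val_inj/eqP; rewrite eqn_leq /= kr andbT -ltnS.
by rewrite preimage_mass_circ_max (le_trans (IH ord0))// leeDl// esum_ge0.
Qed.

End Masses.
End Preimages.

(** * The part of the cycle measure that the branches prescribe *)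

Lemma esumZl (R : realType) (I : countType) (c : R) (F : I -> \bar R) :
  (0 <= c)%R -> (forall i, 0 <= F i) ->
  \esum_(i in [set: I]) (c%:E * F i) = c%:E * \esum_(i in [set: I]) F i.
Proof.
move=> c0 F0; rewrite !esum_countE//; last by move=> i; rewrite mule_ge0// lee_fin.
rewrite -nneseriesZl; last by move=> n _; case: pickle_inv => //=.
by apply: eq_eseriesr => n _; case: pickle_inv => //=; rewrite mule0.
Qed.

Section CycleWeight.
Context (R : realType) (kappa : nat).

Let E : set R := `]1%R, +oo[%classic.

(** The factor that solves t^(kappa+1) M = M + rho for M on (1, oo). Its value 0
    elsewhere makes it nonnegative and the resulting measure null off
    (1, oo). *)
Definition cycle_weight (t : R) : R :=
  if (1 < t)%R then (t ^+ kappa.+1 - 1)^-1%R else 0%R.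

Lemma exprS_gt1 (t : R) : (1 < t)%R -> (0 < t ^+ kappa.+1 - 1)%R.
Proof. by move=> t1; rewrite subr_gt0 exprn_egt1. Qed.

Lemma cycle_weight_ge0 t : (0 <= cycle_weight t)%R.
Proof.
by rewrite /cycle_weight; case: ifPn => // t1; rewrite invr_ge0 ltW// exprS_gt1.
Qed.

Lemma measurable_cycle_weight : measurable_fun setT cycle_weight.
Proof.
have -> : cycle_weight = (fun t => (t ^+ kappa.+1 - 1)^-1%R) \_ E.
  apply/funext => t; rewrite /cycle_weight patchE.
  by rewrite (_ : (t \in E) = (1 < t)%R)// mem_setE in_itv/= andbT.
have mE : measurable (E : set (measurableTypeR R)) by exact: measurable_itv.
apply/(measurable_restrictT _ mE).
apply: open_continuous_measurable_fun; first exact: interval_open.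
move=> t; rewrite inE /E /= in_itv/= andbT => t1.
apply: cvgV; first by rewrite gt_eqF// exprS_gt1.
by apply: cvgB; [exact: exprn_continuous|exact: cvg_cst].
Qed.

End CycleWeight.

Section CycleMeasure.
Context (R : realType) (eta : option nat) (kappa : nat).
Context (mu : {measure set (Xset eta kappa) -> \bar R}).
Context (P : J eta -> probability (measurableTypeR R) R).
Hypothesis hmu : discrete_measure mu.
Hypothesis P_rep : forall i : J eta,
  S_representing (P i) (fun n => hphi mu n (branch kappa i 0)).
Hypothesis P_null : forall i : J eta, P i `[0%R, 1%R]%classic = 0.

Let E : set (measurableTypeR R) := `]1%R, +oo[%classic.
Let D : set (measurableTypeR R) := `[0%R, +oo[%classic.
Let mE : measurable E. Proof. exact: measurable_itv. Qed.
Let mD : measurable D. Proof. exact: measurable_itv. Qed.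
Let c i : R := atom mu (branch kappa i 0).
Let c_gt0 i : (0 < c i)%R. Proof. exact: atomR_gt0. Qed.
Let ED : E `<=` D.
Proof. by move=> t; rewrite /E /D/= !in_itv/= !andbT => /ltW; exact: le_trans. Qed.

Let E_gt1 t : E t -> (1 < t)%R.
Proof. by rewrite /E/= in_itv/= andbT. Qed.

Lemma branch_measure_null i : P i (~` E) = 0.
Proof.
have -> : ~` E = `]-oo, 0%R[%classic `|` `[0%R, 1%R]%classic :> set R.
  apply/seteqP; split => t; rewrite /E/= !in_itv/= ?andbT.
    move=> /negP; rewrite -leNgt => t1; have [t0|t0] := ltP t 0%R; [by left|by right].
  by move=> [t0|/andP[_ t1]]; apply/negP; rewrite -leNgt// ltW// (lt_trans t0).
have N : P i `]-oo, 0%R[%classic = 0 by have [] := P_rep i.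
by rewrite null_set_setU//; exact: P_null.
Qed.

Lemma integral_branch_moment i n :
  (c i)%:E * \int[P i]_(t in E) (t ^+ n)%:E = preimage_mass mu n (branch kappa i 0).
Proof.
have [_ /(_ n)[_]] := P_rep i.
rewrite hphiE// => H; rewrite -(@integral_conull _ _ _ _ E D)//.
- rewrite -H muleC -muleA -EFinM mulVf ?mule1//; exact/lt0r_neq0/c_gt0.
- exact: branch_measure_null.
- by apply/measurable_EFinP; apply: measurable_funTS; exact: measurable_funX.
- by move=> t; rewrite /D/= in_itv/= andbT => t0; rewrite lee_fin exprn_ge0.
Qed.

Lemma cycle_measure_exists :
  exists W : {measure set (measurableTypeR R) -> \bar R},
    W (~` E) = 0 /\
    forall s f, measurable s -> s `<=` E -> measurable_fun s f ->
      (forall t, s t -> 0 <= f t) ->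
      \int[W]_(t in s) f t = \esum_(i in [set: J eta])
        ((c i)%:E * \int[P i]_(t in s) (((t ^+ kappa.+1 - 1)^-1)%:E * f t)).
Proof.
have [nu nuE] := choice (fun i => density_exists (P i)
  (@measurable_cycle_weight R kappa) (@cycle_weight_ge0 R kappa)).
pose nu' i : {measure set (measurableTypeR R) -> \bar R} :=
  mscale (NngNum (ltW (c_gt0 i))) (nu i).
have [W [WA Wint]] := measure_sum_exists nu'.
exists W; split.
  rewrite WA esum1// => i _; rewrite /nu'/= /mscale/= (nuE i).1.
  rewrite integral0_eq ?mule0// => t; rewrite /E /= in_itv/= andbT => /negP t1.
  by rewrite /cycle_weight (negbTE t1).
move=> s f ms sE mf f0; rewrite Wint//; apply: eq_esum => i _.
rewrite /nu' ge0_integral_mscale//=; congr (_ * _); rewrite (nuE i).2//.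
apply: eq_integral => t /set_mem/sE/E_gt1 t1.
by rewrite /cycle_weight t1.
Qed.

Section WithCycleMeasure.
Context (W : {measure set (measurableTypeR R) -> \bar R}).
Hypothesis W_null : W (~` E) = 0.
Hypothesis W_int : forall s f, measurable s -> s `<=` E -> measurable_fun s f ->
  (forall t, s t -> 0 <= f t) ->
  \int[W]_(t in s) f t = \esum_(i in [set: J eta])
    ((c i)%:E * \int[P i]_(t in s) (((t ^+ kappa.+1 - 1)^-1)%:E * f t)).

Let mX n (s : set (measurableTypeR R)) :
  measurable_fun s (fun t : R => (t ^+ n)%:E).
Proof. by apply/measurable_EFinP; apply: measurable_funTS; exact: measurable_funX. Qed.

Let mV (s : set (measurableTypeR R)) : s `<=` E ->
  measurable_fun s (fun t : R => ((t ^+ kappa.+1 - 1)^-1)%:E).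
Proof.
move=> sE; apply/measurable_EFinP.
have := measurable_funTS (@measurable_cycle_weight R kappa) (D := s).
apply: eq_measurable_fun => t /set_mem/sE/E_gt1 t1.
by rewrite /cycle_weight t1.
Qed.

(** The equation of consistency at x_kappa, solved on (1, oo). *)
Lemma cycle_measure_shift s f : measurable s -> s `<=` E -> measurable_fun s f ->
  (forall t, s t -> 0 <= f t) ->
  \int[W]_(t in s) ((t ^+ kappa.+1)%:E * f t) = \int[W]_(t in s) f t +
    \esum_(i in [set: J eta]) ((c i)%:E * \int[P i]_(t in s) f t).
Proof.
move=> ms sE mf f0.
have t0 t : s t -> (0 <= t)%R by move=> /sE/E_gt1/ltW; exact: le_trans.
rewrite !W_int//; last 2 first.
- exact: emeasurable_funM.
- by move=> t st; rewrite mule_ge0 ?f0// lee_fin exprn_ge0// t0.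
have V0 t : s t -> 0 <= ((t ^+ kappa.+1 - 1)^-1)%:E :> \bar R.
  by move=> /sE/E_gt1 t1; rewrite lee_fin invr_ge0 ltW// exprS_gt1.
rewrite -esumD; last 2 first.
- move=> i _; rewrite mule_ge0 ?lee_fin ?(ltW (c_gt0 i))//.
  by apply: integral_ge0 => t st; rewrite mule_ge0 ?V0 ?f0.
- by move=> i _; rewrite mule_ge0 ?lee_fin ?(ltW (c_gt0 i))// integral_ge0.
apply: eq_esum => i _; rewrite -ge0_muleDr; last 2 first.
- by apply: integral_ge0 => t st; rewrite mule_ge0 ?V0 ?f0.
- exact: integral_ge0.
congr (_ * _); rewrite -ge0_integralD//; last 2 first.
- by move=> t st; rewrite mule_ge0 ?V0 ?f0.
- by apply: emeasurable_funM => //; exact: mV.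
apply: eq_integral => t /set_mem st.
have /exprS_gt1 - /(_ kappa) t1 := E_gt1 (sE _ st).
rewrite muleA -EFinM -[X in _ = _ + X]mul1e -ge0_muleDl ?V0//.
congr (_ * _); rewrite -EFinD; congr EFin.
by field; rewrite gt_eqF.
Qed.

Definition cycle_moment m : \bar R := \int[W]_(t in E) (t ^+ m)%:E.

Lemma cycle_moment0 : cycle_moment 0 = W E.
Proof.
rewrite /cycle_moment; under eq_integral do rewrite expr0.
by rewrite integral_cst// mul1e.
Qed.

Lemma cycle_moment_shift n : cycle_moment (n + kappa.+1) = cycle_moment n +
  \esum_(i in [set: J eta]) preimage_mass mu n (branch kappa i 0).
Proof.
rewrite /cycle_moment; under eq_integral do rewrite addnC exprD EFinM.
rewrite cycle_measure_shift//; last first.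
  by move=> t /E_gt1 t1; rewrite lee_fin exprn_ge0// (le_trans _ (ltW t1)).
by congr (_ + _); apply: eq_esum => i _; exact: integral_branch_moment.
Qed.

Hypothesis ic : forall r : 'I_kappa.+1, (0 < r)%N ->
  (\esum_(i in [set: J eta])
    (mu [set branch kappa i 0] / mu [set circ eta r] *
     \int[P i]_(t in `]1%R, +oo[%classic)
       ((t ^+ r - 1) / (t ^+ kappa.+1 - 1))%:E)) +
  mu [set circ eta ord0] / mu [set circ eta r] = 1.

Hypothesis id' : (\esum_(i in [set: J eta])
  (mu [set branch kappa i 0] *
   \int[P i]_(t in `]1%R, +oo[%classic)
     (1 / (t ^+ kappa.+1 - 1))%:E)) < +oo.

Lemma cycle_measure_finite : W E < +oo.
Proof.
rewrite -cycle_moment0 /cycle_moment W_int//.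
move: id'; congr (_ < _); apply: eq_esum => i _; rewrite atomE//.
by congr (_ * _); apply: eq_integral => t _; rewrite expr0 mule1 div1r.
Qed.

(** For r > 0 this is the hypothesis [ic] cleared of denominators, with the
    integral of t^r - 1 against the cycle measure split; for r = 0 both sides
    agree. *)
Lemma cycle_moment_base (r : 'I_kappa.+1) :
  mu [set circ eta r] + W E = cycle_moment r + mu [set circ eta ord0].
Proof.
have [r0|r0] := posnP r.
  rewrite (_ : r = ord0); last exact: val_inj.
  by rewrite cycle_moment0 addeC.
have mr0 : (0 < atom mu (circ eta r))%R by exact: atomR_gt0.
have f0 t : E t -> 0 <= (t ^+ r - 1)%:E.
  by move=> /E_gt1 t1; rewrite lee_fin subr_ge0 exprn_ege1// ltW.
have mf : measurable_fun E (fun t : R => (t ^+ r - 1)%:E).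
  apply/measurable_EFinP; apply: measurable_funTS.
  by apply: measurable_funB => //; exact: measurable_funX.
have -> : cycle_moment r = W E + \int[W]_(t in E) (t ^+ r - 1)%:E.
  rewrite -cycle_moment0 /cycle_moment -ge0_integralD//.
  by apply: eq_integral => t _; rewrite -EFinD expr0 addrC subrK.
have := ic r0; rewrite !(atomE hmu) inver gt_eqF//.
under eq_esum do rewrite atomE// -/(c _).
pose K := \int[W]_(t in E) (t ^+ r - 1)%:E.
have -> : \esum_(i in [set: J eta]) ((c i)%:E * (atom mu (circ eta r))^-1%:E *
    \int[P i]_(t in `]1%R, +oo[%classic) ((t ^+ r - 1) / (t ^+ kappa.+1 - 1))%:E) =
    ((atom mu (circ eta r))^-1)%:E * K.
  rewrite /K W_int// -esumZl; last 2 first.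
  - by rewrite invr_ge0 ltW.
  - move=> i; rewrite mule_ge0 ?lee_fin ?(ltW (c_gt0 i))//.
    apply: integral_ge0 => t Et; rewrite mule_ge0 ?f0// lee_fin invr_ge0 ltW//.
    exact/exprS_gt1/E_gt1.
  apply: eq_esum => i _; rewrite -muleA muleCA; congr (_ * (_ * _)).
  by apply: eq_integral => t _; rewrite -EFinM mulrC.
move=> H.
have {}H : (atom mu (circ eta r))%:E = K + (atom mu (circ eta ord0))%:E.
  have := congr1 (fun z => (atom mu (circ eta r))%:E * z) H.
  rewrite mule1 ge0_muleDr; last 2 first.
  - rewrite mule_ge0// ?lee_fin ?invr_ge0 ?(ltW mr0)//.
    by apply: integral_ge0 => t Et; exact: f0.
  - by rewrite lee_fin mulr_ge0 ?invr_ge0 ?(ltW mr0)// ltW// atomR_gt0.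
  rewrite muleA -!EFinM mulrCA divff ?mulr1 ?gt_eqF// mul1e => <-; by [].
by rewrite -/K addeC H addeA.
Qed.

(** The subtraction-free form of the statement that W + a delta_1 has the
    moments mu(phi^-n {x_r}), for a = mu(x_0) - W(1, oo) of any sign. One step
    of [n] moves along the cycle from x_r to x_{r+1}; from x_kappa it goes back
    to x_0 and picks up the contribution of the branches. *)
Lemma cycle_moment_identity n (r : 'I_kappa.+1) :
  preimage_mass mu n (circ eta r) + W E =
  cycle_moment (n + r) + mu [set circ eta ord0].
Proof.
elim: n r => [|n IH] r; first by rewrite preimage_mass0 cycle_moment_base.
have [rk|kr] := ltnP r kappa.
  by rewrite preimage_mass_circ// IH inordK// addnS addSn.
have -> : r = ord_max by apply/val_inj/eqP; rewrite eqn_leq /= kr andbT -ltnS.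
rewrite preimage_mass_circ_max addeAC IH addn0/= addSnnS cycle_moment_shift.
by rewrite addeAC.
Qed.

End WithCycleMeasure.
End CycleMeasure.

(** * Determinacy and the sign of the atom *)

Section Representing.
Context (R : realType).
Let D : set (measurableTypeR R) := `[0%R, +oo[%classic.
Let mD : measurable D. Proof. exact: measurable_itv. Qed.
Implicit Types nu : {measure set (measurableTypeR R) -> \bar R}.

Lemma measurable_monomial n (s : set (measurableTypeR R)) :
  measurable_fun s (fun t : R => (t ^+ n)%:E).
Proof.
by apply/measurable_EFinP; apply: measurable_funTS; exact: measurable_funX.
Qed.

(** The absolute value makes the density nonnegative on the negative half-line,
    which is null for the measures considered. *)
Lemma measurable_norm_monomial n (k : R) :
  measurable_fun setT (fun t : R => k * `|t| ^+ n)%R.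
Proof.
apply: measurable_funM => //; apply: measurable_funX.
by apply: continuous_measurable_fun => x; exact: norm_continuous.
Qed.

Let D_ge0 t : D t -> (0 <= t)%R.
Proof. by rewrite /D/= in_itv/= andbT. Qed.

Let monomial_ge0 n t : D t -> 0 <= (t ^+ n)%:E.
Proof. by rewrite /D/= in_itv/= andbT => t0; rewrite lee_fin exprn_ge0. Qed.

Lemma S_representing_add_atom nu (g : nat -> \bar R) (c : R) : (0 <= c)%R ->
  S_representing nu g -> exists nu', S_representing nu' (fun n => g n + c%:E) /\
    c%:E <= nu' [set 1%R].
Proof.
move=> c0 [nu0 nug].
have [nu' [nu'A nu'I]] := add_atom_exists nu (1%R : measurableTypeR R) c0.
exists nu'; split; last first.
  by rewrite nu'A indicE mem_set// mule1 leeDr.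
split.
  rewrite /on_Rplus nu'A nu0 add0e indicE memNset ?mule0//=.
  by rewrite in_itv/= ltr10.
move=> n; have [gfin gE] := nug n; split; first by rewrite fin_numD gfin.
rewrite nu'I//; [|exact: measurable_monomial|exact: monomial_ge0].
rewrite -gE indicE mem_set/=; first by rewrite expr1n mul1e mule1.
by rewrite /D/= in_itv/= ler01.
Qed.

Lemma S_representing_shift nu (g : nat -> \bar R) (q : nat) (k : R) : (0 <= k)%R ->
  S_representing nu g ->
  exists nu', S_representing nu' (fun n => k%:E * g (q + n)%N) /\
    has_density nu nu' (fun t => k * `|t| ^+ q)%R.
Proof.
move=> k0 [nu0 nug].
have [nu' [nu'A nu'I]] := density_exists nu (measurable_norm_monomial q k)
  (fun t => mulr_ge0 k0 (exprn_ge0 q (normr_ge0 t))).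
exists nu'; split => //; split.
  rewrite /on_Rplus nu'A null_set_integral//.
  by apply/measurable_EFinP; apply: measurable_funTS; exact: measurable_norm_monomial.
move=> n; have [gfin gE] := nug (q + n)%N; split; first by rewrite fin_numM.
rewrite nu'I//; [|exact: measurable_monomial|exact: monomial_ge0].
rewrite gE -ge0_integralZl_EFin//; [|exact: monomial_ge0|exact: measurable_monomial].
apply: eq_integral => t /set_mem; rewrite /D/= in_itv/= andbT => t0.
by rewrite -!EFinM ger0_norm// exprD mulrA.
Qed.

Lemma S_representing_ext nu (g g' : nat -> \bar R) : g =1 g' ->
  S_representing nu g -> S_representing nu g'.
Proof. by move=> /funext ->. Qed.

End Representing.

Section Measures.
Context (R : realType) (eta : option nat) (kappa : nat).
Context (mu : {measure set (Xset eta kappa) -> \bar R}).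
Context (P : J eta -> probability (measurableTypeR R) R).
Hypothesis hmu : discrete_measure mu.
Hypothesis P_rep : forall i : J eta,
  S_representing (P i) (fun n => hphi mu n (branch kappa i 0)).
Hypothesis P_null : forall i : J eta, P i `[0%R, 1%R]%classic = 0.
Hypothesis ic : forall r : 'I_kappa.+1, (0 < r)%N ->
  (\esum_(i in [set: J eta])
    (mu [set branch kappa i 0] / mu [set circ eta r] *
     \int[P i]_(t in `]1%R, +oo[%classic)
       ((t ^+ r - 1) / (t ^+ kappa.+1 - 1))%:E)) +
  mu [set circ eta ord0] / mu [set circ eta r] = 1.
Hypothesis id' : (\esum_(i in [set: J eta])
  (mu [set branch kappa i 0] *
   \int[P i]_(t in `]1%R, +oo[%classic)
     (1 / (t ^+ kappa.+1 - 1))%:E)) < +oo.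

Let E : set (measurableTypeR R) := `]1%R, +oo[%classic.
Let D : set (measurableTypeR R) := `[0%R, +oo[%classic.
Let mE : measurable E. Proof. exact: measurable_itv. Qed.
Let mD : measurable D. Proof. exact: measurable_itv. Qed.
Let ED : E `<=` D.
Proof. by move=> t; rewrite /E /D/= !in_itv/= !andbT => /ltW; exact: le_trans. Qed.
Let E_gt1 t : E t -> (1 < t)%R.
Proof. by rewrite /E/= in_itv/= andbT. Qed.
Let D_ge0 t : D t -> (0 <= t)%R.
Proof. by rewrite /D/= in_itv/= andbT. Qed.

Let x_kappa : Xset eta kappa := circ eta ord_max.

(** The measure mu(x_0) P(x_0, .) from which the whole family on the cycle is
    recovered: it lives on [1, oo), its moments are the masses of the fibres,
    and it solves the equation of consistency at x_kappa. *)
Definition start_measure (M : {measure set (measurableTypeR R) -> \bar R}) :=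
  [/\ M (~` `[1%R, +oo[%classic) = 0,
      forall n (r : 'I_kappa.+1),
        preimage_mass mu n (circ eta r) = \int[M]_(t in D) (t ^+ (n + r))%:E &
      forall s f, measurable s -> s `<=` D -> measurable_fun s f ->
        (forall t, s t -> 0 <= f t) ->
        \int[M]_(t in s) ((t ^+ kappa.+1)%:E * f t) = \int[M]_(t in s) f t +
        \esum_(i in [set: J eta])
          ((atom mu (branch kappa i 0))%:E * \int[P i]_(t in s) f t)].

Section GivenCycleMeasure.
Context (W : {measure set (measurableTypeR R) -> \bar R}).
Hypothesis W_null : W (~` E) = 0.
Hypothesis W_int : forall s f, measurable s -> s `<=` E -> measurable_fun s f ->
  (forall t, s t -> 0 <= f t) ->
  \int[W]_(t in s) f t = \esum_(i in [set: J eta])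
    ((atom mu (branch kappa i 0))%:E *
      \int[P i]_(t in s) (((t ^+ kappa.+1 - 1)^-1)%:E * f t)).

Let W_fin : W E \is a fin_num.
Proof. by rewrite ge0_fin_numE//; exact: (cycle_measure_finite hmu W_int id'). Qed.

Let identity n r := cycle_moment_identity hmu P_rep P_null W_int ic n r.

(** Otherwise the negative atom at 1, moved to the other side, produces two
    representing measures of one sequence: [nu0] without an atom at 1 and [nu1]
    with one. *)
Lemma determinate_defect q :
  (forall c : R, (0 < c)%R ->
    S_determinate (fun n => hphi mu (q + n) x_kappa + c%:E)) ->
  W E <= mu [set circ eta ord0].
Proof.
move=> det; rewrite leNgt; apply/negP => lt0.
set m0 := atom mu (circ eta ord0); set mk := atom mu x_kappa.
have mk0 : (0 < mk)%R by exact: atomR_gt0.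
pose w := fine (W E); have wE : W E = w%:E by rewrite fineK.
(* The negative atom [m0 - w] of M_0, rescaled to P(x_kappa, .) and with its
   sign changed. *)
pose c : R := ((w - m0) / mk)%R.
have c0 : (0 < c)%R.
  by rewrite divr_gt0// subr_gt0 -lte_fin -wE -atomE.
have c20 : (0 < c / 2)%R by rewrite divr_gt0.
have hfin n : hphi mu (q + n) x_kappa \is a fin_num.
  have [nu [_ /(_ n) [+ _]] _] := det 1%R ltr01.
  by rewrite fin_numD => /andP[].
have cmE n : cycle_moment W (q + n + kappa) =
    mk%:E * (hphi mu (q + n) x_kappa + c%:E).
  have := identity (q + n) ord_max; rewrite -/x_kappa wE atomE//= -/m0.
  rewrite preimage_massE// -/mk -(fineK (hfin n)); set al := fine _ => id.
  have -> : cycle_moment W (q + n + kappa) = (mk * al + w - m0)%:E.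
    by rewrite EFinB EFinD EFinM id addeK.
  rewrite -EFinD -EFinM; congr EFin.
  by rewrite /c; field; rewrite gt_eqF.
have [nu0 [nu0A nu0I]] := density_exists W (measurable_norm_monomial (q + kappa) mk^-1)
  (fun t => mulr_ge0 (ltW (etrans (invr_gt0 mk) mk0)) (exprn_ge0 _ (normr_ge0 t))).
have nu0_null A : measurable A -> A `<=` ~` E -> nu0 A = 0.
  move=> mA AE; rewrite nu0A null_set_integral//.
    by apply/measurable_EFinP; apply: measurable_funTS; exact: measurable_norm_monomial.
  by apply: subset_measure0 W_null => //; exact: measurableC.
have nu0rep : S_representing nu0 (fun n => hphi mu (q + n) x_kappa + c%:E).
  split.
    apply: nu0_null; first exact: measurable_itv.
    move=> t; rewrite /= in_itv/= => t0 /E_gt1; apply/negP; rewrite -leNgt.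
    by rewrite (le_trans (ltW t0)).
  move=> n; split; first by rewrite fin_numD hfin.
  rewrite nu0I//; last 2 first.
  - exact: measurable_monomial.
  - by move=> t /D_ge0 t0; rewrite lee_fin exprn_ge0.
  have fm (s : set (measurableTypeR R)) : measurable_fun s
      (fun t : R => (mk^-1 * `|t| ^+ (q + kappa))%:E * (t ^+ n)%:E).
    apply: emeasurable_funM; last exact: measurable_monomial.
    by apply/measurable_EFinP; apply: measurable_funTS; exact: measurable_norm_monomial.
  rewrite (integral_conull mE mD ED W_null)//; last first.
    by move=> t /D_ge0 t0; rewrite -EFinM lee_fin !mulr_ge0 ?exprn_ge0 ?invr_ge0 ?(ltW mk0).
  transitivity ((mk^-1)%:E * cycle_moment W (q + n + kappa)).
    by rewrite cmE muleA -EFinM mulVf ?mul1e// gt_eqF.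
  rewrite /cycle_moment -ge0_integralZl_EFin//.
  - apply: eq_integral => t /set_mem/ED/D_ge0 t0.
    by rewrite -!EFinM ger0_norm// -mulrA -exprD addnAC.
  - by move=> t /ED/D_ge0 t0; rewrite lee_fin exprn_ge0.
  - exact: measurable_monomial.
  - by rewrite invr_ge0 ltW.
have [nu _ nuU] := det c c0; have [nu' nu'rep _] := det _ c20.
have [nu1 [nu1rep nu1ge]] := S_representing_add_atom (ltW c20) nu'rep.
have m1 : measurable ([set 1%R] : set (measurableTypeR R)) by exact: measurable_set1.
have : nu0 [set 1%R] = nu1 [set 1%R].
  rewrite (nuU _ nu0rep)// (nuU nu1)//.
  apply: S_representing_ext nu1rep => n.
  by rewrite -addeA -EFinD -splitr.
rewrite nu0_null//; last by move=> t /= ->; rewrite /E/= in_itv/= ltxx.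
by move=> E0; move: nu1ge; rewrite -E0 leNgt lte_fin c20.
Qed.

(** The atom is invisible in the equation of consistency at x_kappa, because
    t^(kappa+1) = 1 at t = 1. *)
Lemma start_measure_exists : W E <= mu [set circ eta ord0] ->
  exists M, start_measure M.
Proof.
set m0 := atom mu (circ eta ord0).
pose w := fine (W E); have wE : W E = w%:E by rewrite fineK.
rewrite wE atomE// -/m0 lee_fin -subr_ge0 => a0.
have [M [MA MI]] := add_atom_exists W (1%R : measurableTypeR R) a0.
have t1D : D 1%R by rewrite /D/= in_itv/= ler01.
exists M; split.
- rewrite MA indicE memNset; last by apply; rewrite /= in_itv/= lexx.
  rewrite mule0 adde0; apply: subset_measure0 W_null.
  + by apply: measurableC; exact: measurable_itv.
  + exact: measurableC.
  + by apply: subsetC => t; rewrite /E/= !in_itv/= !andbT; exact: ltW.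
- move=> n r; rewrite MI//; last 2 first.
  + exact: measurable_monomial.
  + by move=> t /D_ge0 t0; rewrite lee_fin exprn_ge0.
  rewrite indicE mem_set// mul1e expr1n mule1.
  rewrite (integral_conull mE mD ED W_null)//; last 2 first.
  + exact: measurable_monomial.
  + by move=> t /D_ge0 t0; rewrite lee_fin exprn_ge0.
  have := identity n r; rewrite wE atomE// -/m0 -/(cycle_moment W (n + r)) => id.
  by rewrite EFinB addeA -id addeK.
- move=> s f ms sD mf f0.
  have mf' : measurable_fun s (fun t => (t ^+ kappa.+1)%:E * f t).
    by apply: emeasurable_funM => //; exact: measurable_monomial.
  have f'0 t : s t -> 0 <= (t ^+ kappa.+1)%:E * f t.
    by move=> st; rewrite mule_ge0 ?f0// lee_fin exprn_ge0// D_ge0//; exact: sD.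
  have msE : measurable (s `&` E) by exact: measurableI.
  have sEs : s `&` E `<=` s by move=> t [].
  rewrite !MI// !(integral_setI_conull mE ms W_null)//.
  rewrite (cycle_measure_shift hmu W_int)//; last 2 first.
  + exact: measurable_funS mf.
  + by move=> t [/f0].
  rewrite expr1n mul1e [RHS]addeAC; congr (_ + _ + _).
  apply: eq_esum => i _; congr (_ * _).
  by rewrite (integral_setI_conull mE ms (branch_measure_null P_rep P_null i)).
Qed.

End GivenCycleMeasure.

Theorem start_measure_of_determinate q :
  (forall c : R, (0 < c)%R ->
    S_determinate (fun n => hphi mu (q + n) x_kappa + c%:E)) ->
  exists M, start_measure M.
Proof.
move=> det; have [W [W_null W_int]] := cycle_measure_exists P hmu.
exact: (start_measure_exists W_null W_int (determinate_defect W_null W_int det)).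
Qed.

End Measures.

(** * The consistent family *)

Section WeightedProbability.
Context (R : realType).
Let D : set (measurableTypeR R) := `[0%R, +oo[%classic.
Let mD : measurable D. Proof. exact: measurable_itv. Qed.
Let D_ge0 t : D t -> (0 <= t)%R.
Proof. by rewrite /D/= in_itv/= andbT. Qed.

Lemma on_Rplus_conull (nu : {measure set (measurableTypeR R) -> \bar R}) :
  on_Rplus nu -> nu (~` D) = 0.
Proof.
have -> : ~` D = `]-oo, 0%R[%classic :> set R.
  apply/seteqP; split => t; rewrite /D/= !in_itv/= andbT ltNge => /negP//.
by [].
Qed.

Lemma weighted_probability_exists
    (m : {measure set (measurableTypeR R) -> \bar R}) (q : nat) (k : R) :
  (0 < k)%R -> on_Rplus m -> \int[m]_(t in D) (t ^+ q)%:E = k%:E ->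
  exists p : probability (measurableTypeR R) R, on_Rplus p /\
    forall s f, measurable s -> s `<=` D -> measurable_fun s f ->
      (forall t, s t -> 0 <= f t) ->
      k%:E * \int[p]_(t in s) f t = \int[m]_(t in s) ((t ^+ q)%:E * f t).
Proof.
move=> k0 mpos mk.
have [nu [nuA nuI]] := density_exists m (measurable_norm_monomial q k^-1)
  (fun t => mulr_ge0 (ltW (etrans (invr_gt0 k) k0)) (exprn_ge0 _ (normr_ge0 t))).
have mg (s : set (measurableTypeR R)) : measurable_fun s
    (fun t : R => (k^-1 * `|t| ^+ q)%:E).
  by apply/measurable_EFinP; apply: measurable_funTS; exact: measurable_norm_monomial.
have g0 t : 0 <= (k^-1 * `|t| ^+ q)%:E.
  by rewrite lee_fin mulr_ge0 ?exprn_ge0 ?invr_ge0// ltW.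
have nu1 : nu setT = 1.
  rewrite nuA (integral_conull mD measurableT (@subsetT _ _) (on_Rplus_conull mpos))//.
  transitivity (\int[m]_(t in D) ((k^-1)%:E * (t ^+ q)%:E)).
    by apply: eq_integral => t /set_mem/D_ge0 t0; rewrite ger0_norm.
  rewrite ge0_integralZl_EFin// ?mk; last 3 first.
  - by move=> t /D_ge0 t0; rewrite lee_fin exprn_ge0.
  - exact: measurable_monomial.
  - by rewrite invr_ge0 ltW.
  by rewrite -EFinM mulVf// gt_eqF.
have [p pE] := probability_exists nu1.
exists p; split.
  apply: etrans (pE _) _; rewrite nuA null_set_integral//; exact: measurable_itv.
move=> s f ms sD mf f0.
rewrite (eq_measure_integral nu); last by move=> A mA _; exact: pE.
rewrite nuI// -ge0_integralZl_EFin//; last 3 first.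
- by move=> t st; rewrite mule_ge0 ?f0.
- exact: emeasurable_funM.
- exact: ltW.
apply: eq_integral => t /set_mem/sD/D_ge0 t0.
by rewrite muleA -EFinM ger0_norm// mulrA divff ?mul1r// gt_eqF.
Qed.

End WeightedProbability.

Section ConsistentFamily.
Context (R : realType) (eta : option nat) (kappa : nat).
Context (mu : {measure set (Xset eta kappa) -> \bar R}).
Context (P : J eta -> probability (measurableTypeR R) R).
Hypothesis hmu : discrete_measure mu.
Hypothesis P_rep : forall i : J eta,
  S_representing (P i) (fun n => hphi mu n (branch kappa i 0)).
Let D : set (measurableTypeR R) := `[0%R, +oo[%classic.
Context (M : {measure set (measurableTypeR R) -> \bar R}).
Hypothesis M_null : M (~` `[1%R, +oo[%classic) = 0.
Hypothesis M_moment : forall n (r : 'I_kappa.+1),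
  preimage_mass mu n (circ eta r) = \int[M]_(t in D) (t ^+ (n + r))%:E.
Hypothesis M_shift : forall s f, measurable s -> s `<=` D ->
  measurable_fun s f -> (forall t, s t -> 0 <= f t) ->
  \int[M]_(t in s) ((t ^+ kappa.+1)%:E * f t) = \int[M]_(t in s) f t +
  \esum_(i in [set: J eta])
    ((atom mu (branch kappa i 0))%:E * \int[P i]_(t in s) f t).

Lemma on_Rplus_start : on_Rplus M.
Proof.
apply: subset_measure0 M_null => //.
- by apply: measurableC; exact: measurable_itv.
- move=> t; rewrite /= !in_itv/= andbT => t0; apply/negP; rewrite -ltNge.
  exact: lt_trans ltr01.
Qed.

(* What consistency forces the integral of [f] against mu(x) P(x, .) to be. *)
Let density_at (x : Xset eta kappa) (s : set (measurableTypeR R))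
    (f : measurableTypeR R -> \bar R) : \bar R :=
  match x with
  | inl r => \int[M]_(t in s) ((t ^+ r)%:E * f t)
  | inr (i, j) => (atom mu (branch kappa i 0))%:E *
      \int[P i]_(t in s) ((t ^+ j)%:E * f t)
  end.

Let fiber_measure_exists (x : Xset eta kappa) :
  exists q : probability (measurableTypeR R) R,
    [/\ on_Rplus q,
        forall i, x = branch kappa i 0 -> q = P i &
        forall s f, measurable s -> s `<=` D -> measurable_fun s f ->
          (forall t, s t -> 0 <= f t) ->
          (atom mu x)%:E * \int[q]_(t in s) f t = density_at x s f].
Proof.
case: x => [r|[i [|j]]].
- have rE : \int[M]_(t in D) (t ^+ r)%:E = (atom mu (circ eta r))%:E.
    by rewrite -(M_moment 0 r) preimage_mass0 atomE.
  have [q [q0 qI]] := weighted_probability_exists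
    (atomR_gt0 hmu (circ eta r)) on_Rplus_start rE.
  by exists q.
- exists (P i); split; first by have [] := P_rep i.
    by move=> i' [->].
  move=> s f ms sD mf f0; rewrite /density_at; congr (_ * _).
  by apply: eq_integral => t _; rewrite expr0 mul1e.
- have [Pi0 Pim] := P_rep i; have [_ jE] := Pim j.+1.
  pose k : R := (atom mu (branch kappa i j.+1) / atom mu (branch kappa i 0))%R.
  have k0 : (0 < k)%R by rewrite divr_gt0// atomR_gt0.
  have kE : \int[P i]_(t in D) (t ^+ j.+1)%:E = k%:E.
    by rewrite -jE hphiE// preimage_mass_branch add0n atomE.
  have [q [q0 qI]] := weighted_probability_exists k0 Pi0 kE.
  exists q; split => // s f ms sD mf f0.
  rewrite /density_at -qI// muleA -EFinM /k mulrCA divff ?mulr1//.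
  by rewrite gt_eqF// atomR_gt0.
Qed.

Theorem consistent_family_exists :
  exists Q : Xset eta kappa -> probability (measurableTypeR R) R,
    [/\ forall x, on_Rplus (Q x),
        forall i : J eta, Q (branch kappa i 0) = P i &
        CC mu Q].
Proof.
have [Q QP] := choice fiber_measure_exists.
exists Q; split.
- by move=> x; have [] := QP x.
- by move=> i; have [_ /(_ i erefl)] := QP (branch kappa i 0).
move=> s ms sD x _.
have QI y f : measurable_fun s f -> (forall t, s t -> 0 <= f t) ->
    (atom mu y)%:E * \int[Q y]_(t in s) f t = density_at y s f.
  by move=> mf f0; have [_ _] := QP y; apply.
have Qs y : mu [set y] * Q y s = density_at y s (cst 1).
  by rewrite -QI// integral_cst// mul1e atomE.
have mid : measurable_fun s (fun t : R => t%:E) by exact/measurable_EFinP.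
suff H : \esum_(y in @phi eta kappa @^-1` [set x]) (mu [set y] * Q y s) =
    density_at x s (fun t => t%:E).
  have t0 t : s t -> 0 <= t%:E by move=> /sD; rewrite /D/= in_itv/= andbT.
  rewrite H -QI// atomE// inver gt_eqF ?atomR_gt0// muleA -EFinM mulVf ?mul1e//.
  by rewrite gt_eqF// atomR_gt0.
have nn y : 0 <= mu [set y] * Q y s by rewrite mule_ge0.
case: x => [r|[i j]]; last first.
  rewrite -/(branch kappa i j) phi_preimage_branch esum_set1// Qs /density_at/=.
  congr (_ * _); apply: eq_integral => t _.
  by rewrite mule1 exprSr EFinM.
rewrite -/(circ eta r).
have [rk|kr] := ltnP r kappa.
  rewrite phi_preimage_circ// esum_set1// Qs /density_at/= inordK//.
  by apply: eq_integral => t _; rewrite mule1 exprSr EFinM.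
have -> : r = ord_max by apply/val_inj/eqP; rewrite eqn_leq /= kr andbT -ltnS.
rewrite phi_preimage_circ_max (esumID [set circ eta ord0])//.
set B := \bigcup_(i in _) _.
have -> : ([set circ eta ord0] `|` B) `&` [set circ eta ord0] =
    [set circ eta ord0].
  by apply/seteqP; split => y; [case|move=> ->; split => //; left].
have -> : ([set circ eta ord0] `|` B) `&` ~` [set circ eta ord0] =
    (fun i => branch kappa i 0) @` [set: J eta].
  apply/seteqP; split => y; first by move=> [[//|[i _ ->]] _]; exists i.
  by move=> [i _ <-]; split => //; right; exists i.
rewrite esum_set1// esum_image; last by move=> i i' _ _ [].
rewrite Qs /density_at/=.
have -> : \int[M]_(t in s) ((t ^+ kappa)%:E * t%:E) =
    \int[M]_(t in s) ((t ^+ kappa.+1)%:E * cst 1 t).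
  by apply: eq_integral => t _; rewrite mule1 exprSr EFinM.
rewrite M_shift//; congr (_ + _).
  by apply: eq_integral => t _; rewrite expr0 mul1e.
apply: eq_esum => i _; rewrite Qs /density_at/=; congr (_ * _).
by apply: eq_integral => t _; rewrite expr0 mul1e.
Qed.

End ConsistentFamily.

(** * Functions of finite support *)

Section DenseDomain.
Context (R : realType) (eta : option nat) (kappa : nat).
Context (mu : {measure set (Xset eta kappa) -> \bar R}).
Local Notation X := (Xset eta kappa).

Let mX (A : set X) : measurable A. Proof. by []. Qed.

Let mfX d (T : measurableType d) (A : set X) (f : X -> T) : measurable_fun A f.
Proof. by move=> _ Y _; exact: mX. Qed.

Lemma L2normE (f : X -> R[i]) :
  L2norm mu f = (\int[mu]_x ((Normc.normc (f x) ^+ 2)%R)%:E) `^ (2^-1)%R.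
Proof.
rewrite /L2norm unlock; congr (_ `^ _); apply: eq_integral => x _ /=.
have n0 : (0 <= Normc.normc (f x))%R by case: (f x) => a b; exact: sqrtr_ge0.
by rewrite ger0_norm// powR_mulrn.
Qed.

Let sq_ge0 (f : X -> R[i]) x : 0 <= ((Normc.normc (f x) ^+ 2)%R)%:E.
Proof. by rewrite lee_fin sqr_ge0. Qed.

Lemma L2E (f : X -> R[i]) :
  L2 mu f <-> \int[mu]_x ((Normc.normc (f x) ^+ 2)%R)%:E < +oo.
Proof.
rewrite /L2/= L2normE.
have : 0 <= \int[mu]_x ((Normc.normc (f x) ^+ 2)%R)%:E by exact: integral_ge0.
case: (\int[mu]_x _) => [r|//|//] r0.
- by rewrite poweR_EFin !ltry.
- by rewrite poweRyr ?invr_neq0.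
Qed.

Lemma L2norm_lt (f : X -> R[i]) (e : R) : (0 < e)%R ->
  \int[mu]_x ((Normc.normc (f x) ^+ 2)%R)%:E < ((e ^+ 2)%R)%:E ->
  L2norm mu f < e%:E.
Proof.
move=> e0; rewrite L2normE.
have : 0 <= \int[mu]_x ((Normc.normc (f x) ^+ 2)%R)%:E by exact: integral_ge0.
case: (\int[mu]_x _) => [r|//|//]; rewrite lee_fin => r0.
rewrite poweR_EFin !lte_fin powR12_sqrt// => re.
by rewrite -[ltRHS]ger0_norm ?(ltW e0)// -sqrtr_sqr ltr_sqrt// exprn_gt0.
Qed.

(* A countable exhaustion by finite sets, through an enumeration of [X]. *)
Let initial n : set X := [set x | (pickle x < n)%N].

Let finite_support_integral (psi : X -> X) (v : X -> R) n :
  (forall x, mu (psi @^-1` [set x]) < +oo) -> (forall x, (0 <= v x)%R) ->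
  \int[mu]_(x in psi @^-1` initial n) (v (psi x))%:E < +oo.
Proof.
move=> psioo v0; elim: n => [|n IH].
  rewrite (_ : psi @^-1` initial 0 = set0) ?integral_set0 ?ltry//.
  by apply/seteqP; split.
have -> : psi @^-1` initial n.+1 =
    psi @^-1` initial n `|` psi @^-1` [set x | pickle x = n].
  apply/seteqP; split => x; rewrite /initial/=.
    by rewrite ltnS leq_eqVlt => /predU1P[->|]; [right|left].
  by move=> [/ltnW|->].
rewrite ge0_integral_setU//; last 2 first.
- by move=> x _; rewrite lee_fin.
- apply/disj_setPS => x [/=]; rewrite /initial/= => xn E.
  by rewrite E ltnn in xn.
rewrite lte_add_pinfty//.
case E : (@pickle_inv X n) => [y|].
  have -> : [set x : X | pickle x = n] = [set y].
    apply/seteqP; split => x /=.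
      by move=> xn; have := @pickleK_inv X x; rewrite xn E => -[].
    by move=> ->; have := @pickle_invK X n; rewrite E.
  rewrite (eq_integral (cst (v y)%:E)); last first.
    by move=> x /set_mem /= ->.
  have yfin : mu (psi @^-1` [set y]) \is a fin_num by rewrite ge0_fin_numE.
  by rewrite integral_cst// -(fineK yfin) -EFinM ltry.
have -> : [set x : X | pickle x = n] = set0.
  apply/seteqP; split => // x /= xn.
  by have := @pickleK_inv X x; rewrite xn E.
by rewrite preimage_set0 integral_set0 ltry.
Qed.

(** Truncating a function of L^2 to finite sets converges by dominated
    convergence, and a truncation composed with phi is bounded and supported on
    finitely many fibres of finite mass. *)
Theorem Cphi_densely_defined_of_finite :
  (forall x, mu (@phi eta kappa @^-1` [set x]) < +oo) ->
  Cphi_densely_defined mu.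
Proof.
move=> phioo g /L2E gL2 e e0.
pose u (x : X) : R := (Normc.normc (g x) ^+ 2)%R.
pose f_ n (x : X) : R[i] := if (pickle x < n)%N then g x else 0%R.
pose r_ n (x : X) : \bar R := if (pickle x < n)%N then 0 else (u x)%:E.
have normc0 : Normc.normc (0%R : R[i]) = 0%R.
  by rewrite /= expr0n/= addr0 sqrtr0.
have cv : \int[mu]_x r_ n x @[n --> \oo] --> \int[mu]_x (cst 0 x : \bar R).
  have := @dominated_convergence _ _ _ mu setT measurableT r_ (cst 0)
    (fun x => (u x)%:E).
  case=> //.
  - apply/nearW => x _; apply: cvg_near_cst.
    near=> n; rewrite /r_ ifT//; near: n; exact: nbhs_infty_gt.
  - apply/integrableP; split => //.
    move: gL2; congr (_ < _); apply: eq_integral => x _.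
    by rewrite gee0_abs//; exact: sq_ge0.
  - apply/nearW => x n _; rewrite /r_; case: ifPn => _.
      by rewrite abse0 lee_fin sqr_ge0.
    by rewrite gee0_abs// lee_fin sqr_ge0.
rewrite integral0 in cv.
have e20 : (0 < e ^+ 2)%R by rewrite exprn_gt0.
have [n rn] : exists n, \int[mu]_x r_ n x < ((e ^+ 2)%R)%:E.
  apply: contrapT => /forallNP H.
  suff : ((e ^+ 2)%R)%:E <= 0 :> \bar R by rewrite leNgt lte_fin e20.
  rewrite -(cvg_lim _ cv)//; apply: lime_ge.
    by apply/cvg_ex; eexists; exact: cv.
  by apply: nearW => n; rewrite leNgt; exact/negP/H.
exists (f_ n); last first.
  apply: L2norm_lt => //; apply: le_lt_trans rn.
  rewrite le_eqVlt; apply/orP; left; apply/eqP/eq_integral => x _.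
  by rewrite /f_ /r_; case: ifPn => _; rewrite ?subrr ?subr0// normc0 expr0n.
have f_le x : (Normc.normc (f_ n x) ^+ 2 <= u x)%R.
  by rewrite /f_ /u; case: ifPn => // _; rewrite normc0 expr0n/= sqr_ge0.
split; apply/L2E.
  apply: le_lt_trans gL2; apply: ge0_le_integral => // x _; rewrite lee_fin//.
apply: le_lt_trans (finite_support_integral n phioo (fun x => sqr_ge0 (Normc.normc (g x)))).
rewrite [leRHS]integral_mkcond; apply: ge0_le_integral => //.
move=> x _; rewrite patchE /Cphi /f_ /=.
case: ifPn => xn; first by rewrite mem_set.
by rewrite normc0 expr0n /=; case: ifPn => // _; rewrite lee_fin sqr_ge0.
Unshelve. all: by end_near. Qed.

End DenseDomain.

(** * Transfer of determinacy and the main theorem *)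

Section ShiftedMeasures.
Context (R : realType).
Let D : set (measurableTypeR R) := `[0%R, +oo[%classic.
Let G : set (measurableTypeR R) := `]0%R, +oo[%classic.
Let mG : measurable G. Proof. exact: measurable_itv. Qed.
Let mGC : measurable (~` G). Proof. exact: measurableC. Qed.
Implicit Types nu : {measure set (measurableTypeR R) -> \bar R}.

Let restrict_pos nu nu' (B : set (measurableTypeR R)) :
  has_density nu nu' (fun t => 1 * `|t| ^+ 1)%R ->
  measurable B -> B `<=` G -> nu B = \int[nu']_(t in B) (t^-1)%:E.
Proof.
move=> nu'E mB BG.
have t0 t : B t -> (0 < t)%R by move=> /BG; rewrite /G/= in_itv/= andbT.
rewrite nu'E//; last 2 first.
- have : measurable_fun G (fun t : R => (t^-1)%R).
    apply: open_continuous_measurable_fun; first exact: interval_open.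
    move=> t; rewrite inE /G/= in_itv/= andbT => t1.
    by apply: inv_continuous; rewrite gt_eqF.
  move=> mV; apply/measurable_EFinP; exact: measurable_funS BG mV.
- by move=> t /t0 t1; rewrite lee_fin invr_ge0 ltW.
rewrite (eq_integral (cst 1)); last first.
  move=> t /set_mem/t0 t1 /=.
  by rewrite mul1r expr1 gtr0_norm// -EFinM divff// gt_eqF.
by rewrite integral_cst// mul1e.
Qed.

Let split_pos nu (A : set (measurableTypeR R)) : measurable A ->
  nu A = nu (A `&` G) + nu (A `&` ~` G).
Proof.
move=> mA; rewrite -measureU//; try exact: measurableI.
  by rewrite -setIUr setUv setIT.
by rewrite setIACA setICr setI0.
Qed.

Let nonpos_part nu (A : set (measurableTypeR R)) : measurable A -> on_Rplus nu ->
  nu (A `&` ~` G) = if `[< A 0%R >] then nu (~` G) else 0.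
Proof.
move=> mA nu0.
have negE (B : set (measurableTypeR R)) : measurable B -> B `<=` ~` G ->
    ~ B 0%R -> nu B = 0.
  move=> mB BG B0; apply: subset_measure0 nu0 => //.
  move=> t Bt; rewrite /= in_itv/= lt_neqAle; apply/andP; split.
    by apply/eqP => t0; apply: B0; rewrite -t0.
  by have := BG _ Bt; rewrite /G/= in_itv/= andbT => /negP; rewrite -leNgt.
case: asboolP => A0; last by apply: negE => [|t []//|[]//]; exact: measurableI.
rewrite -[in RHS](setIT (~` G)) -(setUv A) setIUr measureU//; last 3 first.
- exact: measurableI.
- by apply: measurableI => //; exact: measurableC.
- by rewrite setIACA setICr setI0.
rewrite [X in _ + X]negE ?adde0 ?[_ `&` A]setIC//.
- by apply: measurableI => //; exact: measurableC.
- by move=> [_]; apply.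
Qed.

(** On (0, oo) a measure is recovered from t nu by the density 1 / t; the point
    0, which t nu does not see, is recovered from the total mass. *)
Lemma eq_measure_of_shift nu1 nu2 nu1' nu2' :
  on_Rplus nu1 -> on_Rplus nu2 -> nu1 D \is a fin_num -> nu1 D = nu2 D ->
  has_density nu1 nu1' (fun t => 1 * `|t| ^+ 1)%R ->
  has_density nu2 nu2' (fun t => 1 * `|t| ^+ 1)%R ->
  (forall A, measurable A -> nu1' A = nu2' A) ->
  forall A, measurable A -> nu1 A = nu2 A.
Proof.
move=> p1 p2 fin1 D12 s1 s2 eq12.
have eqG B : measurable B -> B `<=` G -> nu1 B = nu2 B.
  move=> mB BG; rewrite (restrict_pos s1)// (restrict_pos s2)//.
  by apply: eq_measure_integral => C mC _; exact: eq12.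
have TD nu : on_Rplus nu -> nu setT = nu D.
  move=> p; have mD : measurable D by exact: measurable_itv.
  rewrite -(setUv D) measureU//; [|exact: measurableC|by rewrite setICr].
  exact: etrans (congr1 (fun z => nu D + z) (on_Rplus_conull p)) (adde0 _).
have GT nu : on_Rplus nu -> nu D = nu G + nu (~` G).
  by move=> p; rewrite -TD// (split_pos nu measurableT) !setTI.
have GC : nu1 (~` G) = nu2 (~` G).
  have := D12; rewrite !GT// (eqG G)// => H.
  have G1 : nu2 G \is a fin_num.
    by move: fin1; rewrite GT// (eqG G)// fin_numD => /andP[].
  have := congr1 (fun z => z - nu2 G) H.
  by rewrite ![nu2 G + _]addeC !addeK.
move=> A mA; rewrite (split_pos nu1)// (split_pos nu2)// !nonpos_part// GC.
congr (_ + _); apply: eqG => [|t []//]; exact: measurableI.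
Qed.

End ShiftedMeasures.

Section MainResults.
Context (R : realType) (eta : option nat) (kappa : nat).
Context (mu : {measure set (Xset eta kappa) -> \bar R}).
Hypothesis hmu : discrete_measure mu.
Let D : set (measurableTypeR R) := `[0%R, +oo[%classic.
Let mD : measurable D. Proof. exact: measurable_itv. Qed.
Let x_kappa : Xset eta kappa := circ eta ord_max.
Let mk : R := atom mu x_kappa.
Let mk0 : (0 < mk)%R. Proof. exact: atomR_gt0. Qed.

Lemma hphi_circ_lower_bound :
  exists2 d : R, (0 < d)%R & forall n (r : 'I_kappa.+1), d%:E <= hphi mu n (circ eta r).
Proof.
have [d d0 dle] := circ_mass_lower_bound hmu.
pose e : R := \big[Num.min/1%R]_(r < kappa.+1) (d / atom mu (circ eta r))%R.
exists e; first by rewrite /e; elim/big_ind: _ => [//|x y x0 y0|r _];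
  rewrite ?lt_min ?x0// divr_gt0// atomR_gt0.
move=> n r; apply: (@le_trans _ _ ((d / atom mu (circ eta r))%R)%:E).
  by rewrite lee_fin; exact: bigmin_le_cond.
by rewrite hphiE// EFinM lee_wpmul2r// lee_fin invr_ge0 ltW// atomR_gt0.
Qed.

(** A positive lower bound of h_n(x_kappa) is used twice: it makes the moments
    positive, and it absorbs the constant c into a multiple of h_{n+1}. *)
Lemma shifted_determinate :
  Stieltjes (fun n => hphi mu n x_kappa) -> Carleman (fun n => hphi mu n x_kappa) ->
  forall c : R, (0 < c)%R -> S_determinate (fun n => hphi mu n.+1 x_kappa + c%:E).
Proof.
move=> [nu nurep] car c c0; have [d d0 dle] := hphi_circ_lower_bound.
have hfin n : hphi mu n x_kappa \is a fin_num by have [_ /(_ n) []] := nurep.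
pose g n : R := fine (hphi mu n x_kappa).
have hE n : hphi mu n x_kappa = (g n)%:E by rewrite /g fineK.
have dg n : (d <= g n)%R by rewrite -lee_fin -hE; exact: dle.
have g0 n : (0 < g n)%R by exact: lt_le_trans (dg n).
pose g' n : R := (g n.+1 + c)%R.
have g'0 n : (0 < g' n)%R by rewrite addr_gt0.
have g'div : carleman_divergent g'.
  apply: (@carleman_divergent_le _ (fun n => g n.+1) g' (1 + c / d)) => //.
  - by rewrite lerDl divr_ge0 ?ltW.
  - move=> n; rewrite /g' mulrDl mul1r lerD2l mulrAC ler_pdivlMr//.
    by rewrite ler_wpM2l ?dg// ltW.
  - apply: carleman_divergent_shift => //; apply/CarlemanE => //.
    by rewrite (_ : (fun n => _) = (fun n => hphi mu n x_kappa))//; apply/funext.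
have [nu1 [nu1rep _]] := S_representing_shift 1 ler01 nurep.
have nu1rep' : S_representing nu1 (fun n => hphi mu n.+1 x_kappa).
  by apply: S_representing_ext nu1rep => n; rewrite mul1e add1n.
have [nu2 [nu2rep _]] := S_representing_add_atom (ltW c0) nu1rep'.
exists nu2 => // nu' [nu'0 nu'm]; have [nu20 nu2m] := nu2rep.
apply: (carleman_determinacy (g := g')) => //.
- by move=> n; have [_ <-] := nu'm n; rewrite hE -EFinD.
- by move=> n; have [_ <-] := nu2m n; rewrite hE -EFinD.
Qed.

Section StartMeasure.
Context (M : {measure set (measurableTypeR R) -> \bar R}).
Hypothesis M_null : M (~` `[1%R, +oo[%classic) = 0.
Hypothesis M_moment : forall n (r : 'I_kappa.+1),
  preimage_mass mu n (circ eta r) = \int[M]_(t in D) (t ^+ (n + r))%:E.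

Lemma determinate_of_shifted :
  (forall c : R, (0 < c)%R -> S_determinate (fun n => hphi mu n.+1 x_kappa + c%:E)) ->
  forall c : R, (0 < c)%R -> S_determinate (fun n => hphi mu n x_kappa + c%:E).
Proof.
move=> e2 c c0.
have hfin n : hphi mu n x_kappa \is a fin_num.
  case: n => [|n]; first by rewrite hphiE// preimage_mass0 atomE.
  have [nu [_ /(_ n) [+ _]] _] := e2 c c0.
  by rewrite fin_numD => /andP[].
have Mrep : S_representing M (fun n => \int[M]_(t in D) (t ^+ n)%:E).
  split; first exact: on_Rplus_start M_null.
  move=> n; split => //; have [nk|kn] := ltnP n kappa.+1.
    have := M_moment 0 (Ordinal nk); rewrite add0n => <-.
    by rewrite preimage_mass0 atomE.
  have := M_moment (n - kappa) ord_max; rewrite /= subnK ?(ltnW kn)// => <-.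
  by rewrite preimage_massE// fin_numM.
have mkV0 : (0 <= mk^-1)%R by rewrite invr_ge0 ltW.
have [nu [nurep _]] := S_representing_shift kappa mkV0 Mrep.
have nurep' : S_representing nu (fun n => hphi mu n x_kappa).
  apply: S_representing_ext nurep => n.
  by rewrite hphiE// (M_moment n ord_max) /= addnC muleC.
have [nu1 [nu1rep _]] := S_representing_add_atom (ltW c0) nurep'.
exists nu1 => // nu2 nu2rep.
have [m1 [m1rep m1I]] := S_representing_shift 1 ler01 nu1rep.
have [m2 [m2rep m2I]] := S_representing_shift 1 ler01 nu2rep.
have [m mrep mU] := e2 c c0.
have m12 A : measurable A -> m2 A = m1 A.
  move=> mA; rewrite (mU m1)// ?(mU m2)//.
  - by apply: S_representing_ext m2rep => n; rewrite mul1e add1n.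
  - by apply: S_representing_ext m1rep => n; rewrite mul1e add1n.
have [p1 r1] := nu1rep; have [p2 r2] := nu2rep.
have massE (nu0 : {measure set (measurableTypeR R) -> \bar R}) :
    \int[nu0]_(t in D) (t ^+ 0)%:E = nu0 D.
  by under eq_integral do rewrite expr0; rewrite integral_cst// mul1e.
have [f2 E2] := r2 0%N; have [f1 E1] := r1 0%N.
rewrite -/D massE in E1; rewrite -/D massE in E2.
apply: (eq_measure_of_shift p2 p1 _ _ m2I m1I m12).
- by rewrite -/D -E2.
- by rewrite -/D -E1 -E2.
Qed.

(** On [1, oo) powers increase with the exponent, so among the points of the
    cycle x_kappa has the largest fibres. *)
Lemma circ_Carleman (r : 'I_kappa.+1) :
  (forall n, hphi mu n x_kappa \is a fin_num) ->
  Carleman (fun n => hphi mu n x_kappa) -> Carleman (fun n => hphi mu n (circ eta r)).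
Proof.
move=> hfin car; have [d d0 dle] := hphi_circ_lower_bound.
set mr := atom mu (circ eta r); have mr0 : (0 < mr)%R by exact: atomR_gt0.
have mF : measurable (`[1%R, +oo[%classic : set (measurableTypeR R)).
  exact: measurable_itv.
have FD : `[1%R, +oo[%classic `<=` D.
  by move=> t; rewrite /D/= !in_itv/= !andbT; exact: le_trans.
have D_ge0 n t : D t -> 0 <= (t ^+ n)%:E.
  by rewrite /D/= in_itv/= andbT => t0; rewrite lee_fin exprn_ge0.
have mass_le n : preimage_mass mu n (circ eta r) <= preimage_mass mu n x_kappa.
  rewrite !M_moment !(integral_conull mF mD FD M_null)//=; last 4 first.
  - exact: measurable_monomial.
  - exact: D_ge0.
  - exact: measurable_monomial.
  - exact: D_ge0.
  apply: ge0_le_integral => //.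
  - by move=> t /FD; exact: D_ge0.
  - exact: measurable_monomial.
  - exact: measurable_monomial.
  - move=> t; rewrite /= in_itv/= andbT => t1.
    by rewrite lee_fin ler_weXn2l// leq_add2l -ltnS.
have h_le n : hphi mu n (circ eta r) <= ((mk / mr)%R)%:E * hphi mu n x_kappa.
  rewrite hphiE// -/mr; apply: le_trans (lee_wpmul2r _ (mass_le n)) _.
    by rewrite lee_fin invr_ge0 ltW.
  by rewrite preimage_massE// -/mk EFinM muleAC.
have rfin n : hphi mu n (circ eta r) \is a fin_num.
  rewrite ge0_fin_numE; last by apply: le_trans (dle n r); rewrite lee_fin ltW.
  by apply: le_lt_trans (h_le n) _; rewrite ltey_eq fin_numM.
pose g n : R := fine (hphi mu n x_kappa).
pose g' n : R := fine (hphi mu n (circ eta r)).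
have gE n : hphi mu n x_kappa = (g n)%:E by rewrite /g fineK.
have g'E n : hphi mu n (circ eta r) = (g' n)%:E by rewrite /g' fineK.
have g0 n : (0 < g n)%R by rewrite -lte_fin -gE; apply: lt_le_trans (dle _ _).
have g'0 n : (0 < g' n)%R by rewrite -lte_fin -g'E; apply: lt_le_trans (dle _ _).
have -> : (fun n => hphi mu n (circ eta r)) = (fun n => (g' n)%:E).
  exact/funext.
apply/CarlemanE => //.
apply: (@carleman_divergent_le _ g g' (1 + mk / mr)) => //.
- by rewrite lerDl divr_ge0 ?ltW.
- move=> n; rewrite mulrDl mul1r ler_wpDl ?(ltW (g0 n))//.
  by rewrite -lee_fin EFinM -gE -g'E.
- by apply/CarlemanE => //; rewrite (_ : (fun n => _) = (fun n => hphi mu n x_kappa))//;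
    apply/funext.
Qed.

End StartMeasure.

Lemma phi_preimage_finite : (hphi mu 1 x_kappa \is a fin_num) ->
  forall x, mu (@phi eta kappa @^-1` [set x]) < +oo.
Proof.
move=> h1 [r|[i j]]; last first.
  by rewrite -/(branch kappa i j) phi_preimage_branch (atomE hmu) ltry.
rewrite -/(circ eta r); have [rk|kr] := ltnP r kappa.
  by rewrite phi_preimage_circ// (atomE hmu) ltry.
have -> : r = ord_max by apply/val_inj/eqP; rewrite eqn_leq /= kr andbT -ltnS.
have : preimage_mass mu 1 x_kappa < +oo.
  by rewrite preimage_massE// ltey_eq fin_numM.
by [].
Qed.

End MainResults.

Theorem theorem4p4p2 (R : realType) (eta : option nat) (kappa : nat)
  (heta : eta <> Some 0%N)
  (mu : {measure set (Xset eta kappa) -> \bar R})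
  (hmu : discrete_measure mu)
  (ia : forall i : J eta, Stieltjes (fun n => hphi mu n (branch kappa i 0)))
  (P : J eta -> probability (measurableTypeR R) R)
  (hP : forall i : J eta, on_Rplus (P i))
  (ib : forall i : J eta,
    S_representing (P i) (fun n => hphi mu n (branch kappa i 0)) /\
    P i `[0%R, 1%R]%classic = 0)
  (ic : forall r : 'I_kappa.+1, (0 < r)%N ->
    (\esum_(i in [set: J eta])
      (mu [set branch kappa i 0] / mu [set circ eta r] *
       \int[P i]_(t in `]1%R, +oo[%classic)
         ((t ^+ r - 1) / (t ^+ kappa.+1 - 1))%:E)) +
    mu [set circ eta ord0] / mu [set circ eta r] = 1)
  (id' : (\esum_(i in [set: J eta])
      (mu [set branch kappa i 0] *
       \int[P i]_(t in `]1%R, +oo[%classic)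
         (1 / (t ^+ kappa.+1 - 1))%:E)) < +oo) :
  let x_kappa : Xset eta kappa := circ eta ord_max in
  let e1 := forall c : R, (0 < c)%R ->
    S_determinate (fun n => hphi mu n x_kappa + c%:E) in
  let e2 := forall c : R, (0 < c)%R ->
    S_determinate (fun n => hphi mu n.+1 x_kappa + c%:E) in
  let e3 := Stieltjes (fun n => hphi mu n x_kappa) /\
    Carleman (fun n => hphi mu n x_kappa) in
  [/\ e3 -> e2,
      e2 -> e1,
      e1 -> Cphi_densely_defined mu /\
        exists Q : Xset eta kappa -> probability (measurableTypeR R) R,
          [/\ forall x, on_Rplus (Q x),
              forall i : J eta, Q (branch kappa i 0) = P i &
              CC mu Q]
    & e3 -> forall r : 'I_kappa.+1, Carleman (fun n => hphi mu n (circ eta r))].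
Proof.
move=> x_kappa e1 e2 e3.
have P_rep i := (ib i).1; have P_null i := (ib i).2.
have start q := start_measure_of_determinate hmu P_rep P_null ic id' (q := q).
have e32 : e3 -> e2 by move=> [st car]; exact: shifted_determinate.
split => //.
- move=> h2; have [M [M0 Mm _]] := start 1%N h2.
  exact: (determinate_of_shifted hmu M0 Mm h2).
- move=> h1; split.
    apply: Cphi_densely_defined_of_finite; apply: phi_preimage_finite => //.
    have [nu [_ /(_ 1%N) [+ _]] _] := h1 1%R ltr01.
    by rewrite fin_numD => /andP[].
  have [M [M0 Mm Ms]] := start 0%N h1.
  exact: (consistent_family_exists hmu P_rep M0 Mm Ms).
- move=> h3 r; have [M [M0 Mm _]] := start 1%N (e32 h3).
  apply: (circ_Carleman hmu M0 Mm); last exact: h3.2.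
  by move=> n; have [nu [_ /(_ n) []]] := h3.1.
Qed.
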